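(* For each $t\in\{1,\dots,T\}$ consider any vector $q^t=(q_j^t)_{j\in N_t}$ with positive entries such that $\mathrm{diag}(r^t)^{-1}\mathbf P^t\,\mathrm{diag}(r^t)^{-1}\preceq\mathrm{diag}(q^t)^{-1}$. Consider ISAEGA (defined in the context, together with $p^t,r^t,\mathbf P^t$) with stepsize $$\alpha=\min_{t,\,j\in N_t,\,i}\frac1{4m_i^j\left(1+\frac1{np_i^tq_j^t}\right)+\frac\sigma{p_i^tq_j^t}} .$$ Then its iteration complexity is $C\log\frac1\epsilon$ with $$C=\max_{t,\,j\in N_t,\,i}\left(4\frac{m_i^j}\sigma\left(1+\frac1{np_i^tq_j^t}\right)+\frac1{p_i^tq_j^t}\right);$$ that is, there exists a matrix $\mathbf B\in\mathbb R^{d\times n}$ with positive entries such that, with $\Psi^k=\|x^k-x^*\|^2+\alpha\sum_{i=1}^d\sum_{j=1}^n\frac{\mathbf B_{ij}^2}{m_i^j}\left(\mathbf J_{ij}^k-\nabla_if_j(x^* )\right)^2$, for every $\epsilon\in(0,1)$ and every integer $k\ge C\log\frac1\epsilon$ we have $\mathbb E[\Psi^k]\le\epsilon\,\Psi^0$.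
   Context: Problem. $f_1,\dots,f_n:\mathbb R^d\to\mathbb R$ are differentiable and convex, $f=\frac1n\sum_{j=1}^n f_j$, $\psi:\mathbb R^d\to\mathbb R\cup\{+\infty\}$ is proper, closed and convex. $\min_x f(x)+\psi(x)$ has a unique minimizer $x^*$, and $f$ is $\sigma$-quasi strongly convex with $\sigma>0$: $f(x^* )\ge f(y)+\langle\nabla f(y),x^*-y\rangle+\frac\sigma2\|y-x^*\|^2$ for all $y$. Each $f_j$ is $\mathrm{diag}(m^j)$-smooth with $m^j\in\mathbb R^d$ having positive entries $m_1^j,\dots,m_d^j$: $f_j(x)\le f_j(y)+\langle\nabla f_j(y),x-y\rangle+\frac12\sum_im_i^j(x_i-y_i)^2$ for all $x,y$. $\mathrm{prox}_{\alpha\psi}(x)=\arg\min_u\{\alpha\psi(u)+\frac12\|u-x\|^2\}$; $\nabla_i$ denotes the $i$-th partial derivative; $\preceq$ is the Loewner order. Distributed samplings. The index set $[n]$ is partitioned into nonempty sets $N_1,\dots,N_T$ (set $N_t$ is owned by machine $t$). For each $t$, $R_t\subseteq N_t$ and $L_t\subseteq[d]$ are random subsets with given distributions; all of $R_1,L_1,\dots,R_T,L_T$ are mutually independent. $p_i^t=\mathbb P(i\in L_t)>0$ for $i\in[d]$, $r_j^t=\mathbb P(j\in R_t)>0$ for $j\in N_t$, $p^t=(p_i^t)_{i\in[d]}$, $r^t=(r_j^t)_{j\in N_t}$, and $\mathbf P^t\in\mathbb R^{|N_t|\times|N_t|}$ has entries $\mathbf P^t_{jj'}=\mathbb P(j\in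 R_t,\,j'\in R_t)$, $j,j'\in N_t$. Algorithm (ISAEGA). Given $x^0\in\mathbb R^d$, set $\mathbf J^0=0\in\mathbb R^{d\times n}$. For $k=0,1,2,\dots$: draw fresh copies $R_t^k,L_t^k$ ($1\le t\le T$) of the samplings, independent of the past; for each $t$, $i\in[d]$, $j\in N_t$, set $\mathbf J_{ij}^{k+1}=\nabla_if_j(x^k)$ if $i\in L_t^k$ and $j\in R_t^k$, and $\mathbf J_{ij}^{k+1}=\mathbf J_{ij}^k$ otherwise; define $g^k\in\mathbb R^d$ by $g_i^k=\frac1n\sum_{j=1}^n\mathbf J_{ij}^k+\frac1n\sum_{t=1}^T\sum_{j\in N_t}\frac1{p_i^tr_j^t}\left(\mathbf J_{ij}^{k+1}-\mathbf J_{ij}^k\right)$; $x^{k+1}=\mathrm{prox}_{\alpha\psi}(x^k-\alpha g^k)$. *)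

(* Defs.v *)
From HB Require Import structures.
From mathcomp Require Import all_boot all_order all_algebra.
From mathcomp Require Import all_classical all_reals all_analysis.

Set Implicit Arguments.
Unset Strict Implicit.
Unset Printing Implicit Defensive.

Import Order.TTheory GRing.Theory Num.Theory.
Import numFieldNormedType.Exports.

Local Open Scope classical_set_scope.
Local Open Scope ring_scope.

(* The canonical norm of 'rV[R]_d is the sup norm; it induces the same topology
   and the same notion of differentiability as the Euclidean norm, whose square
   is [sqnorm]. *)
Definition dot (R : realType) (d : nat) (x y : 'rV[R]_d) : R :=
  \sum_(i < d) x 0 i * y 0 i.

Definition sqnorm (R : realType) (d : nat) (x : 'rV[R]_d) : R := dot x x.

Definition grad (R : realType) (d : nat) (h : 'rV[R]_d -> R) (x : 'rV[R]_d) :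
    'rV[R]_d :=
  \row_i 'D_(delta_mx 0 i) h x.

Definition avg (R : realType) (d n : nat) (f : 'I_n -> 'rV[R]_d -> R)
    (x : 'rV[R]_d) : R :=
  n%:R^-1 * \sum_(j < n) f j x.

Definition diag_smooth (R : realType) (d : nat) (m : 'I_d -> R)
    (h : 'rV[R]_d -> R) : Prop :=
  forall x y : 'rV[R]_d,
    h x <= h y + dot (grad h y) (x - y)
           + 2^-1 * \sum_(i < d) m i * (x 0 i - y 0 i) ^+ 2.

Definition quasi_strongly_convex (R : realType) (d : nat) (sigma : R)
    (xs : 'rV[R]_d) (h : 'rV[R]_d -> R) : Prop :=
  forall y : 'rV[R]_d,
    h xs >= h y + dot (grad h y) (xs - y) + sigma / 2 * sqnorm (y - xs).

Definition eproper (R : realType) (d : nat) (psi : 'rV[R]_d -> \bar R) : Prop :=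
  (forall x, psi x != -oo%E) /\ (exists x, psi x != +oo%E).

(* In \bar R, 0 * +oo = 0, so the endpoints t = 0 and t = 1 are harmless. *)
Definition econvex (R : realType) (d : nat) (psi : 'rV[R]_d -> \bar R) : Prop :=
  forall (t : R) (x y : 'rV[R]_d), 0 <= t <= 1 ->
    (psi (t *: x + (1 - t) *: y)%R <= t%:E * psi x + (1 - t)%:E * psi y)%E.

Definition argmin (R : realType) (V : Type) (F : V -> \bar R) : set V :=
  [set u | forall v, (F u <= F v)%E].

(* The default value 0 is used only if the argmin is empty, which cannot happen
   for alpha > 0 and psi proper, closed and convex. *)
Definition prox (R : realType) (d : nat) (alpha : R) (psi : 'rV[R]_d -> \bar R)
    (x : 'rV[R]_d) : 'rV[R]_d :=
  xget 0 (argmin (fun u => (alpha%:E * psi u + (2^-1 * sqnorm (u - x)%R)%:E)%E)).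

(* An attained bound: min and max without a default value, so that they do not
   exist for an empty index set. *)
Definition is_minimum (R : realType) (A : set R) (a : R) : Prop :=
  A a /\ forall b, A b -> a <= b.

Definition is_maximum (R : realType) (A : set R) (a : R) : Prop :=
  A a /\ forall b, A b -> b <= a.

Definition psd (R : realType) (s : nat) (A : 'M[R]_s) : Prop :=
  A^T = A /\ forall v : 'cV[R]_s, 0 <= (v^T *m A *m v) 0 0.

Definition loewner_le (R : realType) (s : nat) (A B : 'M[R]_s) : Prop :=
  psd (B - A).

(* Events determined by a random element X of a type with the discrete
   sigma-algebra. *)
Definition events (Omega A : Type) (X : Omega -> A) : set_system Omega :=
  preimage_set_system setT X [set: set A].

Definition mutually_independent (R : realType) (dsp : measure_display)
    (Omega : measurableType dsp) (P : probability Omega R) (I : eqType)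
    (E : I -> set_system Omega) : Prop :=
  forall (s : seq I) (F : I -> set Omega), uniq s ->
    (forall i, i \in s -> E i (F i)) ->
    P (\big[setI/setT]_(i <- s) F i) = (\prod_(i <- s) P (F i))%E.

(* The family R_1, ..., R_T, L_1, ..., L_T, with inl t for R_t, inr t for L_t. *)
Definition sampling_events (Omega : Type) (d n T : nat)
    (Rs : 'I_T -> Omega -> {set 'I_n}) (Ls : 'I_T -> Omega -> {set 'I_d})
    (s : 'I_T + 'I_T) : set_system Omega :=
  match s with inl t => events (Rs t) | inr t => events (Ls t) end.

Definition owned_partition (n T : nat) (N : 'I_T -> {set 'I_n}) : Prop :=
  [/\ forall t, N t != finset.set0,
      forall t t', t != t' -> N t :&: N t' = finset.set0 &
      (\bigcup_(t < T) N t)%SET = finset.setT].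

Section Samplings.
Context (R : realType) (dsp : measure_display) (Omega : measurableType dsp).
Variables (P : probability Omega R) (d n T : nat).
Variables (N : 'I_T -> {set 'I_n}).
Variables (Rs : 'I_T -> Omega -> {set 'I_n}) (Ls : 'I_T -> Omega -> {set 'I_d}).

Definition distributed_sampling : Prop :=
  [/\ forall s, sampling_events Rs Ls s `<=` measurable,
      forall t w, Rs t w \subset N t &
      mutually_independent P (sampling_events Rs Ls)].

Definition probL (t : 'I_T) (i : 'I_d) : R := fine (P [set w | i \in Ls t w]).

Definition probR (t : 'I_T) (j : 'I_n) : R := fine (P [set w | j \in Rs t w]).

(* Rows and columns indexed by N_t are indexed by 'I_#|N t| through enum_val. *)
Definition probmx (t : 'I_T) : 'M[R]_#|N t| :=
  \matrix_(a, b) fine (P [set w | enum_val a \in Rs t w /\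
                                  enum_val b \in Rs t w]).

Definition diagN (t : 'I_T) (v : 'I_n -> R) : 'M[R]_#|N t| :=
  diag_mx (\row_a v (enum_val a)).

End Samplings.

(* Independent copies, over the steps k, of the samplings Rs, Ls. *)
Definition fresh_copies (R : realType) (d n T : nat)
    (dsp0 : measure_display) (Omega0 : measurableType dsp0)
    (P0 : probability Omega0 R)
    (Rs : 'I_T -> Omega0 -> {set 'I_n}) (Ls : 'I_T -> Omega0 -> {set 'I_d})
    (dsp : measure_display) (Omega : measurableType dsp)
    (P : probability Omega R)
    (Rk : nat -> 'I_T -> Omega -> {set 'I_n})
    (Lk : nat -> 'I_T -> Omega -> {set 'I_d}) : Prop :=
  [/\ forall k s, sampling_events (Rk k) (Lk k) s `<=` measurable,
      forall k t (B : set {set 'I_n}),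
        P (Rk k t @^-1` B) = P0 (Rs t @^-1` B),
      forall k t (B : set {set 'I_d}),
        P (Lk k t @^-1` B) = P0 (Ls t @^-1` B) &
      mutually_independent P
        (fun ks : nat * ('I_T + 'I_T) =>
           sampling_events (Rk ks.1) (Lk ks.1) ks.2)].

Section ISAEGA.
Variables (R : realType) (d n T : nat).
Variables (f : 'I_n -> 'rV[R]_d -> R) (psi : 'rV[R]_d -> \bar R).
Variables (N : 'I_T -> {set 'I_n}).
Variables (p : 'I_T -> 'I_d -> R) (r : 'I_T -> 'I_n -> R).
Variables (alpha : R) (x0 : 'rV[R]_d).

Definition table_step (Rt : 'I_T -> {set 'I_n}) (Lt : 'I_T -> {set 'I_d})
    (x : 'rV[R]_d) (J : 'M[R]_(d, n)) : 'M[R]_(d, n) :=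
  \matrix_(i, j)
    if [exists t, [&& j \in N t, i \in Lt t & j \in Rt t]]
    then grad (f j) x 0 i else J i j.

Definition estimator (J J' : 'M[R]_(d, n)) : 'rV[R]_d :=
  \row_i (n%:R^-1 * (\sum_(j < n) J i j)
          + n%:R^-1 * \sum_(t < T) \sum_(j in N t)
                        (p t i * r t j)^-1 * (J' i j - J i j)).

Definition isaega_step (Rt : 'I_T -> {set 'I_n}) (Lt : 'I_T -> {set 'I_d})
    (xJ : 'rV[R]_d * 'M[R]_(d, n)) : 'rV[R]_d * 'M[R]_(d, n) :=
  let J' := table_step Rt Lt xJ.1 xJ.2 in
  (prox alpha psi (xJ.1 - alpha *: estimator xJ.2 J'), J').

Fixpoint isaega (Omega : Type) (Rk : nat -> 'I_T -> Omega -> {set 'I_n})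
    (Lk : nat -> 'I_T -> Omega -> {set 'I_d}) (k : nat) (w : Omega) :
    'rV[R]_d * 'M[R]_(d, n) :=
  match k with
  | 0%N => (x0, 0)
  | l.+1 => isaega_step (fun t => Rk l t w) (fun t => Lk l t w)
              (isaega Rk Lk l w)
  end.

End ISAEGA.

Definition lyapunov (R : realType) (d n : nat) (f : 'I_n -> 'rV[R]_d -> R)
    (m : 'I_n -> 'I_d -> R) (xs : 'rV[R]_d) (alpha : R) (B : 'M[R]_(d, n))
    (xJ : 'rV[R]_d * 'M[R]_(d, n)) : R :=
  sqnorm (xJ.1 - xs)
  + alpha * \sum_(i < d) \sum_(j < n)
      (B i j) ^+ 2 / m j i * (xJ.2 i j - grad (f j) xs 0 i) ^+ 2.

Definition stepsize_bound (R : realType) (n : nat) (sigma m p q : R) : R :=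
  (4 * m * (1 + (n%:R * p * q)^-1) + sigma / (p * q))^-1.

Definition complexity_bound (R : realType) (n : nat) (sigma m p q : R) : R :=
  4 * (m / sigma) * (1 + (n%:R * p * q)^-1) + (p * q)^-1.

Definition values (R : realType) (d n T : nat) (N : 'I_T -> {set 'I_n})
    (e : 'I_T -> 'I_n -> 'I_d -> R) : set R :=
  [set a | exists t j i, j \in N t /\ a = e t j i].

(* Main.v *)
(* One step contracts the Lyapunov function: E[Psi^{k+1} | past] is at most
   (1 - alpha sigma) Psi^k, for B_ij^2 = 1 / (2 n p_i^t r_j^t), t the owner of j.

   Since x^* = prox (x^* - alpha grad f(x^* )), nonexpansiveness of prox bounds
   |x^{k+1} - x^*|^2 by |x^k - x^* - alpha (g^k - grad f(x^* ))|^2. The estimator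
   g^k is unbiased; splitting g^k - grad f(x^* ) into a part driven by
   a_ij = grad_i f_j(x^k) - grad_i f_j(x^* ) and a centred part driven by
   b_ij = J_ij^k - grad_i f_j(x^* ), the Loewner condition and the independence of
   the machines bound its second moment by
   (2/n) sum_ij (a_ij^2 (1 + 1/(n p q)) + b_ij^2 / (n p q)). Quasi strong convexity
   and the bound (1/2) sum_i a_ij^2 / m_i^j <= D_{f_j}(x^k, x^* ) on the Bregman
   divergence of a convex diag(m^j)-smooth function make the inner product term
   pay for the a_ij^2, and the decrease (1 - p r) b_ij^2 of the table error pays
   for the b_ij^2. Finally alpha sigma >= 1 / C, so that
   (1 - alpha sigma)^k <= exp (- k / C) <= epsilon. *)
Require Import Defs.
From HB Require Import structures.
From mathcomp Require Import all_boot all_order all_algebra.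
From mathcomp Require Import all_classical all_reals all_analysis.
From mathcomp Require Import measurable_realfun ring lra.

Set Implicit Arguments.
Unset Strict Implicit.
Unset Printing Implicit Defensive.

Import Order.TTheory GRing.Theory Num.Theory.
Import numFieldNormedType.Exports.

Local Open Scope classical_set_scope.
Local Open Scope ring_scope.

(** * Convex functions and proximal maps *)

(** Without a minimum, each point of [K] lies in an open set where [F] exceeds a real level that
    bounds [F] at some other point of [K]. Finitely many of these sets cover [K], and the best of
    the finitely many witnesses lies in none of them. *)
Lemma compact_lsc_argmin (R : realType) (X : ptopologicalType) (K : set X)
    (F : X -> \bar R) :
  compact K -> K !=set0 -> lower_semicontinuous F ->
  exists2 u, K u & forall v, K v -> (F u <= F v)%E.
Proof.
rewrite compact_cover => cptK [w Kw] /lower_semicontinuousP lscF.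
apply: contrapT => nomin.
have above u : K u -> exists2 v, K v & (F v < F u)%E.
  move=> Ku; apply: contrapT => nov; apply: nomin; exists u => // v Kv.
  by rewrite leNgt; apply/negP => ?; apply: nov; exists v.
pose D := [set a : R | exists2 v, K v & (F v <= a%:E)%E].
have [a _||s sD Ks] := cptK _ D (fun a => [set x | (a%:E < F x)%E]).
- exact: lscF.
- move=> u /above[v Kv Fvu].
  have [a va au] : exists2 a : R, (F v <= a%:E)%E & (a%:E < F u)%E.
    case: (F v) Fvu => [r| |] => vu; first by exists r.
      by rewrite ltNge leey in vu.
    case: (F u) vu => [r| |]// _.
      by exists (r - 1); rewrite ?leNye// lte_fin ltrBlDr ltrDl.
    by exists 0; rewrite ?leNye// ltry.
  by exists a => //; exists v.
have [v Kv vs] : exists2 v, K v &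
    forall a, a \in finmap.enum_fset s -> (F v <= a%:E)%E.
  have : forall a, a \in finmap.enum_fset s -> D a by move=> a /sD; rewrite inE.
  elim: (finmap.enum_fset s) => [|a t IHt] Dt; first by exists w.
  have [v Kv vt] : exists2 v, K v & forall a, a \in t -> (F v <= a%:E)%E.
    by apply: IHt => b bt; apply: Dt; rewrite inE bt orbT.
  have [u Ku ua] : D a by apply: Dt; rewrite mem_head.
  have [vu|/ltW uv] := leP (F v) (F u).
    exists v => // b; rewrite inE => /orP[/eqP->|/vt//].
    exact: le_trans ua.
  exists u => // b; rewrite inE => /orP[/eqP->//|/vt].
  exact: le_trans.
by have [a /= /vs Fva] := Ks _ Kv; rewrite ltNge Fva.
Qed.

(** * Inner product, tangents and Bregman divergence of convex functions *)

Section EuclideanConvexity.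
Context (R : realType) (d : nat).
Implicit Types (x y u v : 'rV[R]_d) (c : R).

Lemma dotC x y : dot x y = dot y x.
Proof. by apply: eq_bigr => i _; rewrite mulrC. Qed.

Lemma dotDl x y u : dot (x + y) u = dot x u + dot y u.
Proof. by rewrite -big_split; apply: eq_bigr => i _; rewrite mxE mulrDl. Qed.

Lemma dotZl c x u : dot (c *: x) u = c * dot x u.
Proof. by rewrite /dot mulr_sumr; apply: eq_bigr => i _; rewrite mxE mulrA. Qed.

Lemma dotNl x u : dot (- x) u = - dot x u.
Proof. by rewrite -scaleN1r dotZl mulN1r. Qed.

Lemma dotDr x y u : dot u (x + y) = dot u x + dot u y.
Proof. by rewrite dotC dotDl !(dotC u). Qed.

Lemma dotZr c x u : dot u (c *: x) = c * dot u x.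
Proof. by rewrite dotC dotZl dotC. Qed.

Lemma dotNr x u : dot u (- x) = - dot u x.
Proof. by rewrite dotC dotNl dotC. Qed.

Definition dotE := (dotDl, dotDr, dotNl, dotNr, dotZl, dotZr).

Lemma sqnorm_ge0 x : 0 <= sqnorm x.
Proof. by apply: sumr_ge0 => i _; rewrite -expr2 sqr_ge0. Qed.

Lemma derive_grad (g : 'rV[R]_d -> R) x v :
  differentiable g x -> 'D_v g x = dot (grad g x) v.
Proof.
move=> dg; rewrite deriveE// [v in LHS]matrix_sum_delta big_ord1 linear_sum.
by apply: eq_bigr => i _; rewrite linearZ mxE deriveE// /= mulrC.
Qed.

(** If the tangent at [x] exceeded [g y], the difference quotients towards [y] would exceed
    [g y - g x] near 0, whereas convexity bounds them by [g y - g x] for all steps in (0, 1]. *)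
Lemma convex_above_tangent (g : 'rV[R]_d -> R) x y :
  convex_function setT g -> differentiable g x ->
  g x + dot (grad g x) (y - x) <= g y.
Proof.
move=> cg dg; rewrite -derive_grad// addrC -lerBrDr leNgt; apply/negP => gap.
have dvg : derivable g x (y - x) by exact: diff_derivable.
have /nbhs_ballP[e /= e0 near0] :
  \forall t \near 0^', g y - g x < t^-1 *: ((g \o shift x) (t *: (y - x)) - g x).
  exact: (cvgr_gt _ dvg _ gap).
pose t := Num.min (e / 2) 1.
have t0 : 0 < t by rewrite lt_min ltr01 andbT; lra.
have t1 : t <= 1 by rewrite ge_min lexx orbT.
have te : t < e by rewrite gt_min; apply/orP; left; lra.
have te' : ball 0 e t by rewrite /ball /= sub0r normrN gtr0_norm.
have := near0 t te' (lt0r_neq0 t0); rewrite ltNge => /negP; apply.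
have cgt : g (t *: (y - x) + x) <= t * g y + (1 - t) * g x.
  have <- : t *: y + (1 - t) *: x = t *: (y - x) + x.
    by rewrite scalerBr scalerBl scale1r addrA addrAC.
  exact: (cg (Itv01 (ltW t0) t1) y x (in_setT _) (in_setT _)).
by rewrite [_ *: _]mulrC ler_pdivrMr//; lra.
Qed.

(** Two bounds meet at one auxiliary point [z]: the tangent of [g] at [y] from below and the smooth
    model of [g] at [x] from above. *)
Lemma convex_smooth_bregman (m : 'I_d -> R) (g : 'rV[R]_d -> R) x y :
  convex_function setT g -> (forall z, differentiable g z) ->
  (forall i, 0 < m i) -> diag_smooth m g ->
  2^-1 * \sum_(i < d) (grad g x 0 i - grad g y 0 i) ^+ 2 / m i
    <= g x - g y - dot (grad g y) (x - y).
Proof.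
move=> cg dg m0 smg.
(* This point minimizes, coordinate by coordinate, the smooth upper model at [x] of
   [g - dot (grad g y)]. *)
pose z : 'rV[R]_d := x - \row_i ((grad g x 0 i - grad g y 0 i) / m i).
have le_yz := convex_above_tangent z cg (dg y).
have le_zx := smg z x.
have -> : dot (grad g y) (x - y)
    = dot (grad g y) (z - y) - dot (grad g y) (z - x).
  by rewrite !dotE; ring.
suff : dot (grad g x) (z - x) - dot (grad g y) (z - x)
    + 2^-1 * (\sum_i m i * (z 0 i - x 0 i) ^+ 2)
  = - (2^-1 * \sum_i (grad g x 0 i - grad g y 0 i) ^+ 2 / m i) by lra.
rewrite /dot -sumrB !mulr_sumr -big_split -sumrN; apply: eq_bigr => i _ /=.
by rewrite !mxE; field; exact: lt0r_neq0.
Qed.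

(* Comparing u with u + t (v - u) and letting t tend to 0. *)
Lemma argmin_variational (psi : 'rV[R]_d -> \bar R) (alpha : R) (h : 'rV[R]_d -> R)
    u v (a b G c : R) :
  econvex psi -> 0 < alpha ->
  argmin (fun w => alpha%:E * psi w + (h w)%:E)%E u ->
  psi u = a%:E -> psi v = b%:E ->
  (forall t, 0 < t <= 1 ->
     h (u + t *: (v - u)) <= h u + t * G + t ^+ 2 * c) ->
  alpha * a <= alpha * b + G.
Proof.
move=> cpsi alpha0 minu psiu psiv hle.
rewrite leNgt; apply/negP => gap.
pose D := alpha * a - (alpha * b + G).
have D0 : 0 < D by rewrite subr_gt0.
(* A step so short that the second-order term [t ^+ 2 * c] is at most half of the first-order gap
   [t * D]. *)
pose t := Num.min (D / (`|c| + 1) / 2) 1.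
have c1 : 0 < `|c| + 1 by rewrite ltr_wpDl.
have t0 : 0 < t by rewrite lt_min ltr01 andbT !divr_gt0.
have t1 : t <= 1 by rewrite ge_min lexx orbT.
have tc : t * c <= D / 2.
  rewrite (@le_trans _ _ (t * (`|c| + 1)))//.
    by rewrite ler_wpM2l ?(ltW t0)// (le_trans (ler_norm c))// lerDl.
  by rewrite -ler_pdivlMr// ge_min -mulrA (mulrC (_^-1)) mulrA lexx.
have := cpsi t v u; rewrite t1 (ltW t0) psiu psiv -!EFinM -EFinD => /(_ isT).
have -> : t *: v + (1 - t) *: u = u + t *: (v - u).
  by rewrite scalerBr scalerBl scale1r addrCA.
have := minu (u + t *: (v - u)); rewrite psiu -EFinM -EFinD.
(* At the intermediate point the value [+oo] contradicts convexity and [-oo] contradicts minimality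
   at [u]. *)
case: (psi _) => [s| |].
- rewrite -EFinM -EFinD !lee_fin => le1 le2.
  have := hle t; rewrite t0 t1 => /(_ isT) le3.
  have : alpha * s <= alpha * (t * b + (1 - t) * a) by rewrite ler_pM2l.
  have : t * (t * c) <= t * (D / 2) by rewrite ler_pM2l.
  have : 0 < t * D by rewrite mulr_gt0.
  by rewrite /D; nra.
- by [].
- by rewrite gt0_muleNy ?lte_fin// addNye leeNy_eq.
Qed.

Lemma argmin_fin_num (psi : 'rV[R]_d -> \bar R) (alpha : R) (h : 'rV[R]_d -> R) u :
  eproper psi -> 0 < alpha ->
  argmin (fun w => alpha%:E * psi w + (h w)%:E)%E u ->
  psi u \is a fin_num.
Proof.
move=> [psiNy [w wy]] alpha0 /(_ w); move: (psiNy u) (psiNy w) wy.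
case: (psi u) => [//||//] _; case: (psi w) => [r||] // _ _.
by rewrite gt0_muley ?lte_fin// -EFinM -EFinD addye.
Qed.


(** * Existence and nonexpansiveness of the proximal map *)

Lemma sqnorm_continuous (z : 'rV[R]_d) :
  continuous (fun x : 'rV[R]_d => sqnorm (x - z)).
Proof.
move=> x; have nbhsF := nbhs_filter x.
have cvgi i : (y - z) 0 i @[y --> x] --> (x - z) 0 i.
  rewrite !mxE; under eq_fun do rewrite !mxE.
  by apply: cvgB; [exact: (@coord_continuous _ _ _ 0 i x)|exact: cvg_cst].
apply: cvg_big => [|i _]; first exact: add_continuous.
exact: (cvgM (cvgi i) (cvgi i)).
Qed.

(** The set is closed and sits in a box of half-width [c + 1], because [t ^+ 2 <= c] forces
    [|t| <= (c + 1) / 2], with no square root of [c] involved. *)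
Lemma sqnorm_ball_compact (z : 'rV[R]_d) c : compact [set x | sqnorm (x - z) <= c].
Proof.
have := @rV_compact R d (fun i => `[z 0 i - (c + 1), z 0 i + (c + 1)]%classic).
move=> /(_ (fun=> @segment_compact _ _ _)) => cptK.
apply: (subclosed_compact _ cptK).
  have : closed ((fun x => sqnorm (x - z)) @^-1` [set r | r <= c]).
    by apply: closed_comp => [x _|]; [exact: sqnorm_continuous|exact: closed_le].
  by [].
move=> x /= xc i; rewrite in_itv /=.
have : ((x - z) 0 i) ^+ 2 <= c.
  apply: le_trans xc; rewrite /sqnorm /dot (bigD1 i)//= expr2 lerDl.
  by apply: sumr_ge0 => j _; rewrite -expr2 sqr_ge0.
rewrite !mxE; have [t tE] : exists t, t = x 0 i - z 0 i by exists (x 0 i - z 0 i).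
rewrite -tE => tc; have := sqr_ge0 t.
have := sqr_ge0 (t - 1); have := sqr_ge0 (t + 1); rewrite sqrrD1 sqrrB1.
by move=> ? ? ?; apply/andP; split; lra.
Qed.

(** The affine minorant of [psi] makes the proximal objective coercive: a sublevel set at a finite
    value lies in a compact ball, on which lower semicontinuity yields a minimizer. *)
Lemma prox_exists (psi : 'rV[R]_d -> \bar R) (alpha : R) x (g : 'rV[R]_d) c :
  eproper psi -> lower_semicontinuous psi -> 0 < alpha ->
  (forall v, (c + dot g v)%:E <= psi v)%E ->
  exists u,
    argmin (fun u => alpha%:E * psi u + (2^-1 * sqnorm (u - x))%:E)%E u.
Proof.
move=> [psiNy [w wy]] lscpsi alpha0 minor.
set G : 'rV[R]_d -> \bar R := fun u => (_ + _)%E.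
have lscG : lower_semicontinuous G.
  move=> u a Ga.
  (* A level [b] strictly below [psi u] that still keeps the objective above [a]; both strict
     inequalities persist near [u]. *)
  have [b bpsi ab] : exists2 b, (b%:E < psi u)%E &
      a < alpha * b + 2^-1 * sqnorm (u - x).
    move: Ga; rewrite /G; case psiu : (psi u) (psiNy u) => [r||]// _.
      rewrite -EFinM -EFinD lte_fin => Ga.
      pose e := (alpha * r + 2^-1 * sqnorm (u - x) - a) / (2 * alpha).
      have e0 : 0 < e by rewrite divr_gt0 ?mulr_gt0// subr_gt0.
      exists (r - e); first by rewrite lte_fin ltrBlDr ltrDl.
      have : alpha * e = (alpha * r + 2^-1 * sqnorm (u - x) - a) / 2.
        by rewrite /e; field; exact: lt0r_neq0.
      by lra.
    move=> _; exists ((a - 2^-1 * sqnorm (u - x) + 1) / alpha).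
      by rewrite ltry.
    by rewrite mulrC divfK ?lt0r_neq0//; lra.
  have /= [V uV Vpsi] := lscpsi _ _ bpsi.
  exists (V `&` [set y | 2 * (a - alpha * b) < sqnorm (y - x)]) =>
      [|y [/Vpsi by1 /= ly]].
    apply: filterI => //; apply: (cvgr_gt _ (@sqnorm_continuous x u)). lra.
  rewrite /G; move: by1; case: (psi y) (psiNy y) => [r||]// _.
    rewrite lte_fin -EFinM -EFinD lte_fin => br.
    have : alpha * b < alpha * r by rewrite ltr_pM2l.
    lra.
  by move=> _; rewrite gt0_muley ?lte_fin// addye// ltry.
(* Completing the square in minorant plus quadratic moves the centre from [x] to this point. *)
pose z := x - alpha *: g.
have Glow v : ((alpha * (c + dot g x) + 2^-1 * sqnorm (v - z)
    - alpha ^+ 2 / 2 * sqnorm g)%:E <= G v)%E.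
  have := minor v; rewrite /G; case: (psi v) => [r||]//.
    rewrite -EFinM -EFinD !lee_fin => le1.
    have : alpha * (c + dot g v) <= alpha * r by rewrite ler_pM2l.
    suff -> : alpha * (c + dot g x) + 2^-1 * sqnorm (v - z)
        - alpha ^+ 2 / 2 * sqnorm g =
      alpha * (c + dot g v) + 2^-1 * sqnorm (v - x) by lra.
    rewrite /z /sqnorm !dotE (dotC x v) (dotC v g) (dotC x g); by field.
  by move=> _; rewrite gt0_muley ?lte_fin// addye// leey.
have Gw : exists r, G w = r%:E.
  rewrite /G; case: (psi w) (psiNy w) wy => [r||]// _ _.
  by eexists; rewrite -EFinM -EFinD.
have [r Gwr] := Gw.
pose rho := 2 * (r - alpha * (c + dot g x) + alpha ^+ 2 / 2 * sqnorm g).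
have inK v : (G v <= r%:E)%E -> sqnorm (v - z) <= rho.
  by move=> /(le_trans (Glow v)); rewrite lee_fin /rho; lra.
have [|u Ku minu] := @compact_lsc_argmin _ _ _ G (@sqnorm_ball_compact z rho) _ lscG.
  by exists w; apply: inK; rewrite Gwr.
exists u => v; have [/inK/minu//|/ltW lev] := leP (G v) r%:E.
by apply: le_trans lev; rewrite -Gwr; apply: minu; apply: inK; rewrite Gwr.
Qed.

(* If -g is a subgradient of psi at xs then xs = prox (xs - alpha g), and
   proximal maps are nonexpansive. *)
Lemma prox_dist (psi : 'rV[R]_d -> \bar R) (alpha : R) (xs g : 'rV[R]_d) a x :
  eproper psi -> lower_semicontinuous psi -> econvex psi -> 0 < alpha ->
  psi xs = a%:E ->
  (forall v b, psi v = b%:E -> a <= b + dot g (v - xs)) ->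
  sqnorm (prox alpha psi x - xs) <= sqnorm (x + alpha *: g - xs).
Proof.
move=> ppsi lpsi cpsi alpha0 psixs subg.
have [|u0 argu0] := @prox_exists psi alpha x (- g) (a + dot g xs) ppsi lpsi alpha0.
  move=> v; case psiv : (psi v) => [b||]; last 2 first.
  - by rewrite leey.
  - by case: ppsi => /(_ v); rewrite psiv.
  by rewrite lee_fin; have := subg v b psiv; rewrite !dotE; lra.
rewrite /prox; case: xgetP => [u _ argu|/(_ u0)//].
have /fineK/esym psiu := argmin_fin_num ppsi alpha0 argu.
have le1 := subg _ _ psiu.
have := @argmin_variational psi alpha _ u xs _ _ (dot (u - x) (xs - u))
  (2^-1 * sqnorm (xs - u)) cpsi alpha0 argu psiu psixs.
have hle t : 0 < t <= 1 -> 2^-1 * sqnorm (u + t *: (xs - u) - x) <=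
    2^-1 * sqnorm (u - x) + t * dot (u - x) (xs - u)
    + t ^+ 2 * (2^-1 * sqnorm (xs - u)).
  move=> _; rewrite le_eqVlt; apply/orP; left; apply/eqP.
  by rewrite /sqnorm !dotE (dotC x u) (dotC xs u) (dotC xs x); field.
move=> /(_ hle) le2.
have le3 : alpha * a <= alpha * (fine (psi u) + dot g (u - xs)) by rewrite ler_pM2l.
(* With y = x + alpha g, adding [le2] and [le3] gives |u - xs|^2 <= <y - xs, u - xs>; then |y - u|^2
   >= 0 turns this into |u - xs| <= |y - xs|. *)
have := sqnorm_ge0 (x + alpha *: g - xs - (u - xs)).
move: le2 le3; rewrite /sqnorm !dotE (dotC u x) (dotC xs u) (dotC xs x).
by rewrite (dotC u g) (dotC xs g) (dotC x g); nra.
Qed.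

End EuclideanConvexity.

(** * The one-step contraction *)

Section FiniteMean.
Context (R : realType) (S : finType) (pi : S -> R).
Implicit Types phi : S -> R.

(** A step has finitely many sampling outcomes, so its expectation is a finite weighted sum; [pi]
    becomes a probability mass only through the two hypotheses below. *)
Definition fmean phi : R := \sum_s pi s * phi s.

Lemma fmeanD phi phi' : fmean (fun s => phi s + phi' s) = fmean phi + fmean phi'.
Proof. by rewrite /fmean -big_split; apply: eq_bigr => s _; rewrite mulrDr. Qed.

Lemma fmeanZ c phi : fmean (fun s => c * phi s) = c * fmean phi.
Proof. by rewrite /fmean mulr_sumr; apply: eq_bigr => s _; rewrite mulrCA. Qed.

Lemma fmean_sum (I : Type) (l : seq I) (Q : pred I) (phi : I -> S -> R) :
  fmean (fun s => \sum_(i <- l | Q i) phi i s) = \sum_(i <- l | Q i) fmean (phi i).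
Proof. by rewrite exchange_big; apply: eq_bigr => s _; rewrite mulr_sumr. Qed.

Hypothesis pi_ge0 : forall s, 0 <= pi s.
Hypothesis pi_sum : \sum_s pi s = 1.

Lemma fmean_cst c : fmean (fun=> c) = c.
Proof. by rewrite /fmean -mulr_suml pi_sum mul1r. Qed.

Lemma le_fmean phi phi' : (forall s, phi s <= phi' s) -> fmean phi <= fmean phi'.
Proof. by move=> le12; apply: ler_sum => s _; rewrite ler_wpM2l. Qed.

End FiniteMean.

(** * Second moments of the gradient estimator *)

Lemma sqr_sum_le (R : realType) (n : nat) (a : 'I_n -> R) :
  (\sum_j a j) ^+ 2 <= n%:R * \sum_j a j ^+ 2.
Proof.
case: n a => [|n] a; first by rewrite !big_ord0 expr2 !mul0r.
set s := \sum_j a j; have n0 : (0 : R) < n.+1%:R by rewrite ltr0Sn.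
(* The squared deviations from the mean of [a] have a nonnegative sum. *)
have : 0 <= \sum_j (a j - s / n.+1%:R) ^+ 2.
  by apply: sumr_ge0 => j _; exact: sqr_ge0.
have -> : \sum_j (a j - s / n.+1%:R) ^+ 2 = \sum_j a j ^+ 2 - s ^+ 2 / n.+1%:R.
  under eq_bigr do rewrite sqrrB.
  rewrite big_split sumrB /= sumr_const card_ord sumrMnl -mulr_suml -/s.
  rewrite -mulr_natl; field; exact: lt0r_neq0.
by rewrite subr_ge0 ler_pdivrMr// mulrC.
Qed.

(* X j indicates that the j-th entry is refreshed; the entries are grouped by
   their owner o j, distinct owners being uncorrelated. *)
Lemma second_moment (R : realType) (S : finType) (pi : S -> R) (n T : nat)
    (o : 'I_n -> 'I_T) (X : 'I_n -> S -> R) (p : 'I_T -> R) (r q : 'I_n -> R)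
    (K : 'I_n -> 'I_n -> R) (c : 'I_n -> R) :
  (forall t, 0 < p t) -> (forall j, 0 < r j) ->
  (forall j j', o j = o j' ->
     fmean pi (fun s => X j s * X j' s) = p (o j) * K j j') ->
  (forall j j', o j != o j' ->
     fmean pi (fun s => X j s * X j' s) = (p (o j) * r j) * (p (o j') * r j')) ->
  (forall t, \sum_(j | o j == t) \sum_(j' | o j' == t)
       c j * c j' * (K j j' / (r j * r j')) <= \sum_(j | o j == t) c j ^+ 2 / q j) ->
  fmean pi (fun s => (\sum_j X j s / (p (o j) * r j) * c j) ^+ 2)
    <= (\sum_j c j) ^+ 2 + \sum_j c j ^+ 2 / (p (o j) * q j).
Proof.
move=> p0 r0 XXsame XXdiff loew.
have -> : fmean pi (fun s => (\sum_j X j s / (p (o j) * r j) * c j) ^+ 2) =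
    \sum_j \sum_j' c j * c j' / ((p (o j) * r j) * (p (o j') * r j'))
      * fmean pi (fun s => X j s * X j' s).
  transitivity (fmean pi (fun s => \sum_j \sum_j'
      c j * c j' / ((p (o j) * r j) * (p (o j') * r j')) * (X j s * X j' s))).
    congr fmean; apply/funext => s; rewrite expr2 mulr_suml; apply: eq_bigr => j _.
    rewrite mulr_sumr; apply: eq_bigr => j' _.
    by field; rewrite !lt0r_neq0.
  rewrite fmean_sum; apply: eq_bigr => j _; rewrite fmean_sum.
  by apply: eq_bigr => j' _; rewrite fmeanZ.
(* Pairs of entries split into those with a common owner, grouped by that owner, and those with
   distinct owners. *)
have blocks (F : 'I_n -> 'I_n -> R) : \sum_j \sum_j' F j j' =
    \sum_t \sum_(j | o j == t) \sum_(j' | o j' == t) F j j'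
    + \sum_j \sum_(j' | o j != o j') F j j'.
  rewrite [LHS](partition_big o xpredT)//=.
  rewrite [X in _ = _ + X](partition_big o xpredT)//=.
  rewrite -big_split; apply: eq_bigr => t _ /=; rewrite -big_split.
  apply: eq_bigr => j /eqP <-; rewrite (bigID (fun j' => o j' == o j))/=.
  by congr (_ + _); apply: eq_bigl => j'; rewrite eq_sym.
rewrite blocks expr2 mulr_suml.
under [X in _ <= X + _]eq_bigr do rewrite mulr_sumr.
(* Pairs with distinct owners contribute equally to both sides, so the rest is compared owner by
   owner. *)
rewrite blocks [in leRHS]addrAC lerD//; last first.
  apply: ler_sum => j _; apply: ler_sum => j' jj'; rewrite XXdiff//.
  by rewrite divfK// !mulf_neq0// lt0r_neq0.
rewrite [X in _ <= _ + X](partition_big o xpredT)//= -big_split.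
(* On the right, the block coming from [(\sum_j c j) ^+ 2] is itself the square of a partial sum and
   may be dropped. *)
apply: ler_sum => t _ /=; rewrite -[leLHS]add0r lerD//.
  under eq_bigr do rewrite -mulr_sumr.
  by rewrite -mulr_suml -expr2 sqr_ge0.
have -> : \sum_(j | o j == t) c j ^+ 2 / (p (o j) * q j) =
    (p t)^-1 * \sum_(j | o j == t) c j ^+ 2 / q j.
  by rewrite mulr_sumr; apply: eq_bigr => j /eqP->; rewrite invfM mulrCA.
apply: le_trans (ler_wpM2l _ (loew t)); last by rewrite invr_ge0 ltW.
rewrite mulr_sumr; apply: ler_sum => j ojt; rewrite mulr_sumr.
apply: ler_sum => j' oj't; rewrite XXsame; last by rewrite (eqP ojt) (eqP oj't).
rewrite (eqP ojt) (eqP oj't) le_eqVlt; apply/orP; left; apply/eqP.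
by field; rewrite !lt0r_neq0.
Qed.
(** Up to the factor [n%:R^-1], one coordinate of the estimator is [sb + Z a - Z b], where [Z c] is
    unbiased for the sum of [c]. The square of [Z a] plus the centred [sb - Z b] is at most twice
    the sum of their squares, and centring removes [sb ^+ 2] from the second moment of [Z b]. *)
Lemma estimator_mean (R : realType) (S : finType) (pi : S -> R) (n : nat)
    (X : 'I_n -> S -> R) (p r q a b : 'I_n -> R) (e alpha : R) :
  (forall s, 0 <= pi s) -> \sum_s pi s = 1 ->
  (forall j, 0 < p j) -> (forall j, 0 < r j) ->
  (forall j, fmean pi (X j) = p j * r j) ->
  (forall c : 'I_n -> R,
     fmean pi (fun s => (\sum_j X j s / (p j * r j) * c j) ^+ 2)
       <= (\sum_j c j) ^+ 2 + \sum_j c j ^+ 2 / (p j * q j)) ->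
  fmean pi (fun s => (e - alpha * (n%:R^-1 *
      \sum_j (b j + X j s / (p j * r j) * (a j - b j)))) ^+ 2)
    <= e ^+ 2 - 2 * alpha * (e * (n%:R^-1 * \sum_j a j))
       + 2 * alpha ^+ 2 * (n%:R^-1 *
           \sum_j (a j ^+ 2 * (1 + (n%:R * p j * q j)^-1)
                   + b j ^+ 2 * (n%:R * p j * q j)^-1)).
Proof.
move=> pi0 pi1 p0 r0 EX EXX.
have [n0|n0] := posnP n.
  (* For [n = 0] the inverse of 0 is 0 and both sides reduce to [e ^+ 2]. *)
  subst n; rewrite invr0 !mul0r !mulr0 subr0 addr0.
  under [fmean pi _]eq_bigr do rewrite mul0r mulr0 subr0.
  by rewrite -mulr_suml pi1 mul1r.
have n0R : (n%:R : R) != 0 by rewrite pnatr_eq0 -lt0n.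
pose Z (c : 'I_n -> R) s := \sum_j X j s / (p j * r j) * c j.
have EZ c : fmean pi (Z c) = \sum_j c j.
  rewrite fmean_sum; apply: eq_bigr => j _.
  transitivity (fmean pi (fun s => c j / (p j * r j) * X j s)).
    by congr fmean; apply/funext => s; ring.
  by rewrite fmeanZ EX divfK// mulf_neq0// lt0r_neq0.
pose k := 2 * alpha ^+ 2 * n%:R^-1 ^+ 2.
have k0 : 0 <= k by rewrite /k -mulrA mulr_ge0// mulr_ge0// sqr_ge0.
pose l := 2 * alpha * (e * n%:R^-1).
set sa := \sum_j a j; set sb := \sum_j b j.
have le1 : fmean pi (fun s => (e - alpha * (n%:R^-1 *
      \sum_j (b j + X j s / (p j * r j) * (a j - b j)))) ^+ 2) <=
    fmean pi (fun s => (e ^+ 2 - l * sb + k * sb ^+ 2) + (- l * Z a s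
      + ((l - 2 * k * sb) * Z b s + (k * Z a s ^+ 2 + k * Z b s ^+ 2)))).
  apply: le_fmean => // s.
  have -> : \sum_j (b j + X j s / (p j * r j) * (a j - b j)) = sb + Z a s - Z b s.
    by rewrite -addrA -sumrB -big_split; apply: eq_bigr => j _ /=; ring.
  rewrite -subr_ge0.
  have -> : e ^+ 2 - l * sb + k * sb ^+ 2 + (- l * Z a s
      + ((l - 2 * k * sb) * Z b s + (k * Z a s ^+ 2 + k * Z b s ^+ 2)))
      - (e - alpha * (n%:R^-1 * (sb + Z a s - Z b s))) ^+ 2
      = (alpha * n%:R^-1 * (Z a s - sb + Z b s)) ^+ 2.
    by rewrite /k /l; ring.
  exact: sqr_ge0.
apply: le_trans le1 _.
rewrite fmeanD fmean_cst// fmeanD fmeanZ fmeanD fmeanZ fmeanD !fmeanZ.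
rewrite !EZ -/sa -/sb.
have la : k * fmean pi (fun s => Z a s ^+ 2)
    <= k * (n%:R * \sum_j a j ^+ 2 + \sum_j a j ^+ 2 / (p j * q j)).
  by rewrite ler_wpM2l// (le_trans (EXX a))// lerD2r sqr_sum_le.
have lb : k * fmean pi (fun s => Z b s ^+ 2)
    <= k * (sb ^+ 2 + \sum_j b j ^+ 2 / (p j * q j)) by rewrite ler_wpM2l// EXX.
have -> : 2 * alpha ^+ 2 * (n%:R^-1 *
           \sum_j (a j ^+ 2 * (1 + (n%:R * p j * q j)^-1)
                   + b j ^+ 2 * (n%:R * p j * q j)^-1)) =
   k * (n%:R * \sum_j a j ^+ 2 + \sum_j a j ^+ 2 / (p j * q j)
        + \sum_j b j ^+ 2 / (p j * q j)).
  rewrite mulr_sumr -!big_split !mulr_sumr; apply: eq_bigr => j _ /=.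
  have -> : (n%:R * p j * q j)^-1 = n%:R^-1 * (p j * q j)^-1 by rewrite -mulrA invfM.
  by set iv := (p j * q j)^-1; rewrite /k; field.
suff -> : e ^+ 2 - 2 * alpha * (e * (n%:R^-1 * sa)) =
  e ^+ 2 - l * sb + k * sb ^+ 2 + (- l * sa + (l - 2 * k * sb) * sb) + k * sb ^+ 2.
  by lra.
by rewrite /l; ring.
Qed.

(* The weight (2 n p r m)^-1 balances the decrease of the squared table error
   against the variance it contributes. *)
Lemma weight_balance (R : realType) (n m p r q sigma alpha a b : R) :
  0 < n -> 0 < m -> 0 < p -> 0 < r -> 0 < q -> 0 < sigma -> 0 < alpha -> q <= r ->
  alpha * (4 * m * (1 + (n * p * q)^-1) + sigma / (p * q)) <= 1 ->
  0 <= a -> 0 <= b ->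
  - (alpha * (n^-1 * (a / m)))
  + 2 * alpha ^+ 2 * (n^-1 * (a * (1 + (n * p * q)^-1) + b * (n * p * q)^-1))
  + alpha * ((2 * n * p * r)^-1 / m * (b + p * r * (a - b)))
  <= (1 - alpha * sigma) * (alpha * ((2 * n * p * r)^-1 / m * b)).
Proof.
move=> n0 m0 p0 r0 q0 sigma0 alpha0 qr step a0 b0.
have npq0 : 0 < (n * p * q)^-1 by rewrite invr_gt0 !mulr_gt0.
set kappa := (n * p * q)^-1 in step npq0 *.
have pqr : alpha * (sigma / (p * r)) <= alpha * (sigma / (p * q)).
  by rewrite !ler_pM2l// lef_pV2 ?posrE ?mulr_gt0// ler_pM2l.
have pq0 : 0 <= alpha * (sigma / (p * q)).
  by rewrite mulr_ge0 ?divr_ge0 ?mulr_ge0 ?ltW.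
have am0 : 0 <= alpha * m by rewrite mulr_ge0 ?ltW.
have c0 : 0 <= alpha / (2 * n * m) by rewrite divr_ge0 ?mulr_ge0 ?ltW.
(* The right side minus the left is exactly the sum of the two terms below, one for [a] and one for
   [b]. The stepsize condition makes each nonnegative, [q <= r] serving to compare [sigma / (p * r)]
   with [sigma / (p * q)]. *)
have ca : (alpha / (2 * n * m)) * (a * (1 - 4 * (alpha * m) * (1 + kappa))) >= 0.
  by rewrite mulr_ge0// mulr_ge0//; nra.
have cb : (alpha / (2 * n * m)) *
    (b * (1 - 4 * (alpha * m) * kappa - alpha * (sigma / (p * r)))) >= 0.
  by rewrite mulr_ge0// mulr_ge0//; nra.
rewrite -subr_ge0; move: (addr_ge0 ca cb); congr (0 <= _).
by field; rewrite ?lt0r_neq0.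
Qed.

(** * Optimality of the minimizer and contraction of the Lyapunov function *)

Lemma grad_avg (R : realType) (d n : nat) (f : 'I_n -> 'rV[R]_d -> R) x :
  (forall j x, differentiable (f j) x) ->
  grad (avg f) x = n%:R^-1 *: \sum_(j < n) grad (f j) x.
Proof.
move=> df; apply/rowP => i; rewrite !mxE summxE.
have -> : avg f = n%:R^-1 *: (\sum_(j < n) f j).
  by apply/funext => y; rewrite /avg fctE fct_sumE.
have dvf j : derivable (f j) x (delta_mx 0 i) by exact: diff_derivable.
rewrite deriveZ; last exact: derivable_sum.
rewrite derive_sum//; congr (_ * _).
by apply: eq_bigr => j _; rewrite mxE.
Qed.

Lemma grad_avg_coord (R : realType) (d n : nat) (f : 'I_n -> 'rV[R]_d -> R) x i :
  (forall j x, differentiable (f j) x) ->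
  grad (avg f) x 0 i = n%:R^-1 * \sum_(j < n) grad (f j) x 0 i.
Proof.
move=> df; rewrite grad_avg//; move: (fun j => grad (f j) x) => h.
by rewrite mxE summxE.
Qed.

Lemma dot_sum (R : realType) (d n : nat) (g : 'I_n -> 'rV[R]_d) v :
  dot (\sum_(j < n) g j) v = \sum_(j < n) dot (g j) v.
Proof.
rewrite exchange_big; apply: eq_bigr => i _ /=.
by rewrite summxE mulr_suml.
Qed.

(** Smoothness of the [f j] supplies the second-order bound along segments that [argmin_variational]
    asks for; the outcome is first-order optimality in the form that [prox_dist] consumes. *)
Lemma avg_minimizer_subgradient (R : realType) (d n : nat)
    (f : 'I_n -> 'rV[R]_d -> R) (m : 'I_n -> 'I_d -> R)
    (psi : 'rV[R]_d -> \bar R) xs :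
  (forall j x, differentiable (f j) x) -> (forall j, diag_smooth (m j) (f j)) ->
  eproper psi -> econvex psi ->
  argmin (fun x => ((avg f x)%:E + psi x)%E) xs ->
  exists a, psi xs = a%:E /\
    forall v b, psi v = b%:E -> a <= b + dot (grad (avg f) xs) (v - xs).
Proof.
move=> df smf ppsi cpsi minxs.
have minxs' : argmin (fun w => (1%:E * psi w + (avg f w)%:E)%E) xs.
  by move=> v; rewrite !mul1e ![(psi _ + _)%E]addeC.
have /fineK/esym psixs := argmin_fin_num ppsi ltr01 minxs'.
exists (fine (psi xs)); split=> // v b psiv.
have := @argmin_variational _ _ _ _ _ _ v _ _ (dot (grad (avg f) xs) (v - xs))
  (n%:R^-1 * \sum_(j < n) (2^-1 * \sum_(i < d) m j i * (v - xs) 0 i ^+ 2))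
  cpsi ltr01 minxs' psixs psiv.
rewrite !mul1r; apply => t _.
rewrite grad_avg// dotZl dot_sum /avg.
have -> : n%:R^-1 * (\sum_(j < n) f j xs)
   + t * (n%:R^-1 * \sum_(j < n) dot (grad (f j) xs) (v - xs))
   + t ^+ 2 * (n%:R^-1 * \sum_(j < n) (2^-1 * \sum_(i < d) m j i * (v - xs) 0 i ^+ 2))
  = n%:R^-1 * \sum_(j < n) (f j xs + t * dot (grad (f j) xs) (v - xs)
     + t ^+ 2 * (2^-1 * \sum_(i < d) m j i * (v - xs) 0 i ^+ 2)).
  by rewrite !big_split /= -!mulr_sumr; ring.
apply: ler_wpM2l; first by rewrite invr_ge0.
apply: ler_sum => j _; have := smf j (xs + t *: (v - xs)) xs.
have -> : xs + t *: (v - xs) - xs = t *: (v - xs) by rewrite addrC addKr.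
rewrite dotZr mulrCA.
suff -> : \sum_(i < d) m j i * ((xs + t *: (v - xs)) 0 i - xs 0 i) ^+ 2
  = t ^+ 2 * \sum_(i < d) m j i * (v - xs) 0 i ^+ 2 by [].
by rewrite mulr_sumr; apply: eq_bigr => i _; rewrite !mxE; ring.
Qed.

(** The randomness enters only through finitely many outcomes and the first two moments of the
    refresh indicators [X i j], which keeps machines and measures out of the estimate. *)
Lemma lyapunov_contraction (R : realType) (d n : nat)
    (f : 'I_n -> 'rV[R]_d -> R) (psi : 'rV[R]_d -> \bar R)
    (xs : 'rV[R]_d) (sigma : R) (m : 'I_n -> 'I_d -> R)
    (S : finType) (pi : S -> R) (X : 'I_d -> 'I_n -> S -> bool)
    (p : 'I_d -> 'I_n -> R) (r q : 'I_n -> R) (alpha : R)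
    (B : 'M[R]_(d, n)) (x : 'rV[R]_d) (J : 'M[R]_(d, n))
    (g : S -> 'rV[R]_d) (step : S -> 'rV[R]_d * 'M[R]_(d, n)) :
  (forall j x, differentiable (f j) x) ->
  (forall j, convex_function setT (f j)) ->
  (forall j, diag_smooth (m j) (f j)) -> (forall j i, 0 < m j i) ->
  eproper psi -> lower_semicontinuous psi -> econvex psi ->
  argmin (fun x => ((avg f x)%:E + psi x)%E) xs ->
  0 < sigma -> quasi_strongly_convex sigma xs (avg f) ->
  (forall s, 0 <= pi s) -> \sum_s pi s = 1 ->
  (forall i j, 0 < p i j) -> (forall j, 0 < r j) -> (forall j, 0 < q j) ->
  (forall j, q j <= r j) ->
  (forall i j, fmean pi (fun s => (X i j s)%:R) = p i j * r j) ->
  (forall i (c : 'I_n -> R),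
     fmean pi (fun s => (\sum_j (X i j s)%:R / (p i j * r j) * c j) ^+ 2)
       <= (\sum_j c j) ^+ 2 + \sum_j c j ^+ 2 / (p i j * q j)) ->
  0 < alpha ->
  (forall i j, alpha * (4 * m j i * (1 + (n%:R * p i j * q j)^-1)
                        + sigma / (p i j * q j)) <= 1) ->
  (forall i j, B i j ^+ 2 = (2 * n%:R * p i j * r j)^-1) ->
  (forall s, (step s).1 = prox alpha psi (x - alpha *: g s)) ->
  (forall s i j, (step s).2 i j = if X i j s then grad (f j) x 0 i else J i j) ->
  (forall s i, g s 0 i = n%:R^-1 *
     \sum_j (J i j + (X i j s)%:R / (p i j * r j) * (grad (f j) x 0 i - J i j))) ->
  fmean pi (fun s => lyapunov f m xs alpha B (step s))
    <= (1 - alpha * sigma) * lyapunov f m xs alpha B (x, J).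
Proof.
move=> df cf smf m0 ppsi lpsi cpsi minxs sigma0 qsc pi0 pi1 p0 r0 q0 qr EX EXX
  alpha0 stepsize BE step1 step2 gE.
have [a [psixs subg]] := avg_minimizer_subgradient df smf ppsi cpsi minxs.
pose a_ i j := grad (f j) x 0 i - grad (f j) xs 0 i.
pose b_ i j := J i j - grad (f j) xs 0 i.
pose w i j := (2 * n%:R * p i j * r j)^-1 / m j i.
pose e := x - xs.
(* Outcome by outcome: [prox_dist] bounds the distance part, and since [X i j s] is 0 or 1 a table
   entry has squared error [b ^+ 2 + X * (a ^+ 2 - b ^+ 2)]. *)
have le1 s : lyapunov f m xs alpha B (step s) <=
    \sum_i (e 0 i - alpha * (n%:R^-1 *
      \sum_j (b_ i j + (X i j s)%:R / (p i j * r j) * (a_ i j - b_ i j)))) ^+ 2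
    + alpha * \sum_i \sum_j w i j * (b_ i j ^+ 2
        + (X i j s)%:R * (a_ i j ^+ 2 - b_ i j ^+ 2)).
  rewrite /lyapunov lerD//; last first.
    rewrite ler_pM2l// ler_sum// => i _; rewrite ler_sum// => j _.
    rewrite step2 BE /w /a_ /b_; case: (X i j s).
      by rewrite mul1r addrCA subrr addr0.
    by rewrite mul0r addr0.
  rewrite step1; apply: le_trans (prox_dist _ ppsi lpsi cpsi alpha0 psixs subg) _.
  rewrite le_eqVlt; apply/orP; left; apply/eqP; apply: eq_bigr => i _.
  have coord (u v y z : 'rV[R]_d) c :
      (u - c *: v + c *: y - z) 0 i = u 0 i - z 0 i - c * (v 0 i - y 0 i).
    by rewrite !mxE; ring.
  rewrite -expr2; congr (_ ^+ 2); rewrite coord gE grad_avg_coord//.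
  have -> : e 0 i = x 0 i - xs 0 i by rewrite !mxE.
  rewrite -mulrBr -sumrB; congr (_ - alpha * (_ * _)).
  by apply: eq_bigr => j _; rewrite /a_ /b_; ring.
apply: le_trans (le_fmean pi0 le1) _.
rewrite fmeanD fmean_sum fmeanZ fmean_sum.
under [X in _ + _ * X <= _]eq_bigr => i _.
  rewrite fmean_sum.
  under eq_bigr => j _.
    rewrite fmeanZ fmeanD fmean_cst//.
    have -> : fmean pi (fun s => (X i j s)%:R * (a_ i j ^+ 2 - b_ i j ^+ 2))
        = p i j * r j * (a_ i j ^+ 2 - b_ i j ^+ 2).
      by under [fmean _ _]eq_bigr do rewrite mulrA; rewrite -mulr_suml -EX.
    over.
  over.
have le2 i : fmean pi (fun s => (e 0 i - alpha * (n%:R^-1 *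
      \sum_j (b_ i j + (X i j s)%:R / (p i j * r j) * (a_ i j - b_ i j)))) ^+ 2)
   <= e 0 i ^+ 2 - 2 * alpha * (e 0 i * (n%:R^-1 * \sum_j a_ i j))
       + 2 * alpha ^+ 2 * (n%:R^-1 *
           \sum_j (a_ i j ^+ 2 * (1 + (n%:R * p i j * q j)^-1)
                   + b_ i j ^+ 2 * (n%:R * p i j * q j)^-1)).
  by apply: (estimator_mean (X := fun j s => (X i j s)%:R)).
apply: le_trans (lerD (ler_sum _ (fun i _ => le2 i)) (lexx _)) _.
(* Unbiasedness leaves this inner product; the Bregman bound and quasi strong convexity at [x]
   together bound it from below. *)
have ip : \sum_i e 0 i * (n%:R^-1 * \sum_j a_ i j) =
    dot (grad (avg f) x) e - dot (grad (avg f) xs) e.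
  rewrite /dot -sumrB; apply: eq_bigr => i _.
  by rewrite !grad_avg_coord// /a_ sumrB; ring.
have breg : n%:R^-1 * \sum_j (2^-1 * \sum_i a_ i j ^+ 2 / m j i) <=
    avg f x - avg f xs - dot (grad (avg f) xs) e.
  rewrite grad_avg// dotZl dot_sum /avg -!mulrBr -!sumrB.
  apply: ler_wpM2l; first by rewrite invr_ge0.
  by apply: ler_sum => j _; exact: convex_smooth_bregman.
have := qsc x; rewrite -opprB -/e dotNr => qscx.
have {}ip : n%:R^-1 * \sum_j (2^-1 * \sum_i a_ i j ^+ 2 / m j i)
    + sigma / 2 * sqnorm e <= \sum_i e 0 i * (n%:R^-1 * \sum_j a_ i j).
  by rewrite ip; lra.
have balance i j : - (alpha * (n%:R^-1 * (a_ i j ^+ 2 / m j i)))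
  + 2 * alpha ^+ 2 * (n%:R^-1 * (a_ i j ^+ 2 * (1 + (n%:R * p i j * q j)^-1)
                                 + b_ i j ^+ 2 * (n%:R * p i j * q j)^-1))
  + alpha * (w i j * (b_ i j ^+ 2 + p i j * r j * (a_ i j ^+ 2 - b_ i j ^+ 2)))
  <= (1 - alpha * sigma) * (alpha * (w i j * b_ i j ^+ 2)).
  have n0 : (0 : R) < n%:R by rewrite ltr0n; apply: leq_trans (ltn_ord j).
  by apply: weight_balance; rewrite ?sqr_ge0.
have {}balance :
  - (alpha * (n%:R^-1 * \sum_i \sum_j a_ i j ^+ 2 / m j i))
  + 2 * alpha ^+ 2 * (n%:R^-1 * \sum_i \sum_j
      (a_ i j ^+ 2 * (1 + (n%:R * p i j * q j)^-1)
       + b_ i j ^+ 2 * (n%:R * p i j * q j)^-1))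
  + alpha * (\sum_i \sum_j
      w i j * (b_ i j ^+ 2 + p i j * r j * (a_ i j ^+ 2 - b_ i j ^+ 2)))
  <= (1 - alpha * sigma) * (alpha * \sum_i \sum_j w i j * b_ i j ^+ 2).
  rewrite !mulr_sumr -sumrN -!big_split /=; apply: ler_sum => i _.
  rewrite !mulr_sumr -sumrN -!big_split /=; apply: ler_sum => j _.
  exact: balance.
rewrite big_split sumrB /= -!mulr_sumr.
have exch : \sum_j (2^-1 * \sum_i a_ i j ^+ 2 / m j i) =
   2^-1 * \sum_i \sum_j a_ i j ^+ 2 / m j i.
  by rewrite -mulr_sumr exchange_big.
rewrite exch in ip.
have eE : \sum_i e 0 i ^+ 2 = sqnorm e by apply: eq_bigr => i _; rewrite expr2.
rewrite eE {1}/lyapunov -/e.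
have -> : \sum_i \sum_j B i j ^+ 2 / m j i * ((x, J).2 i j - grad (f j) xs 0 i) ^+ 2
   = \sum_i \sum_j w i j * b_ i j ^+ 2.
  by apply: eq_bigr => i _; apply: eq_bigr => j _; rewrite BE.
(* Scaling [ip] by [2 * alpha] produces the factor [1 - alpha * sigma] on [sqnorm e] and the
   negative term that [balance] consumes. *)
have : 2 * alpha * (n%:R^-1 * (2^-1 * \sum_i \sum_j a_ i j ^+ 2 / m j i)
    + sigma / 2 * sqnorm e)
   <= 2 * alpha * \sum_i e 0 i * (n%:R^-1 * \sum_j a_ i j).
  by rewrite ler_wpM2l// mulr_ge0// ltW.
by lra.
Qed.

(** * Random samplings and the expectation of a step *)

Section FiniteRange.
Context (R : realType) (dsp : measure_display) (Omega : measurableType dsp).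
Context (P : probability Omega R) (F : finType) (Z : Omega -> F).
Hypothesis mZ : forall z, measurable [set w | Z w = z].

(** [phi (Z w)] is a finite sum of values times indicators of level sets; nonnegativity lets the
    integral pass through the sum. *)
Lemma expectation_finite_range (phi : F -> R) : (forall z, 0 <= phi z) ->
  ('E_P[fun w => phi (Z w)] =
  (fmean (fun z => fine (P [set w | Z w = z])) phi)%:E)%E.
Proof.
move=> phi0; rewrite unlock.
transitivity (\int[P]_w \sum_z ((phi z)%:E * (\1_[set w | Z w = z] w)%:E))%E.
  apply: eq_integral => w _; rewrite (bigD1 (Z w))//= indicE mem_set// mule1.
  rewrite big1 ?adde0// => z zw; rewrite indicE memNset ?mule0// => Zw.
  by rewrite Zw eqxx in zw.
rewrite ge0_integral_sum//; last 2 first.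
- move=> z; apply: measurable_funeM; apply/measurable_EFinP.
  exact: measurable_indic.
- by move=> z w _; rewrite mule_ge0// lee_fin.
rewrite /fmean -sumEFin; apply: eq_bigr => z _.
rewrite ge0_integralZl_EFin//; last first.
  by apply/measurable_EFinP; exact: measurable_indic.
by rewrite integral_indic// setIT EFinM fineK ?fin_num_measure// muleC.
Qed.

Lemma fmean_finite_range (A : pred F) :
  fmean (fun z => fine (P [set w | Z w = z])) (fun z => (A z)%:R)
  = fine (P [set w | A (Z w)]).
Proof.
have mA : measurable [set w | A (Z w)].
  have -> : [set w | A (Z w)] = \big[setU/set0]_(z | A z) [set w | Z w = z].
    apply/seteqP; split => [w Aw|w].
      by rewrite -bigcup_seq_cond; exists (Z w) => //=; rewrite mem_index_enum.
    by rewrite -bigcup_seq_cond => -[z /= /andP[_ Az] ->].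
  by apply: bigsetU_measurable.
apply: EFin_inj; rewrite -expectation_finite_range// fineK ?fin_num_measure//.
rewrite -expectation_indic//; congr ('E_P[_])%E; apply/funext => w.
rewrite indicE; case: (boolP (A (Z w))) => Aw; first by rewrite mem_set.
by rewrite memNset//; exact/negP.
Qed.

Lemma sum_finite_range : \sum_z fine (P [set w | Z w = z]) = 1.
Proof.
have := fmean_finite_range predT; rewrite /fmean.
under eq_bigr do rewrite mulr1; move=> ->.
by rewrite (_ : [set w | _] = setT) ?probability_setT//; apply/seteqP.
Qed.

End FiniteRange.

Lemma eventsP (Omega A : Type) (X : Omega -> A) (B : set A) :
  events X (X @^-1` B).
Proof. by exists B => //; rewrite setTI. Qed.

(** * Independence of the past and the expectation along the run *)

Section Sampling.
Context (d n T : nat).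

(** All choices made in one step, bundled into one value; finite functions make the type finite,
    which turns expectations into finite sums. *)
Definition sample : finType :=
  ({ffun 'I_T -> {set 'I_n}} * {ffun 'I_T -> {set 'I_d}})%type.

Definition sample_of (Omega : Type) (Rt : 'I_T -> Omega -> {set 'I_n})
    (Lt : 'I_T -> Omega -> {set 'I_d}) (w : Omega) : sample :=
  ([ffun t => Rt t w], [ffun t => Lt t w]).

Definition sample_slice (Omega : Type) (Rt : 'I_T -> Omega -> {set 'I_n})
    (Lt : 'I_T -> Omega -> {set 'I_d}) (s : sample) (c : 'I_T + 'I_T) :
    set Omega :=
  match c with
  | inl t => Rt t @^-1` [set s.1 t]
  | inr t => Lt t @^-1` [set s.2 t]
  end.

Lemma sample_slice_events (Omega : Type) (Rt : 'I_T -> Omega -> {set 'I_n})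
    (Lt : 'I_T -> Omega -> {set 'I_d}) s c :
  sampling_events Rt Lt c (sample_slice Rt Lt s c).
Proof. by case: c => t; exact: eventsP. Qed.

Lemma sample_ofE (Omega : Type) (Rt : 'I_T -> Omega -> {set 'I_n})
    (Lt : 'I_T -> Omega -> {set 'I_d}) s :
  [set w | sample_of Rt Lt w = s] =
  \big[setI/setT]_(c : 'I_T + 'I_T) sample_slice Rt Lt s c.
Proof.
rewrite -bigcap_seq; apply/seteqP; split => [w /= <- [] t _ /=|w /= ws].
- by rewrite ffunE.
- by rewrite ffunE.
rewrite (surjective_pairing s); congr pair; apply/ffunP => t; rewrite ffunE.
  by apply: (ws (inl t)); rewrite /= mem_index_enum.
by apply: (ws (inr t)); rewrite /= mem_index_enum.
Qed.

Lemma sample_of_measurable (dsp : measure_display) (Omega : measurableType dsp)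
    (Rt : 'I_T -> Omega -> {set 'I_n}) (Lt : 'I_T -> Omega -> {set 'I_d}) :
  (forall c, sampling_events Rt Lt c `<=` measurable) ->
  forall s, measurable [set w | sample_of Rt Lt w = s].
Proof.
move=> mRL s; rewrite sample_ofE; apply: bigsetI_measurable => c _.
by apply: mRL; exact: sample_slice_events.
Qed.

Section Copies.
Context (R : realType).
Context (dsp0 : measure_display) (Omega0 : measurableType dsp0).
Context (P0 : probability Omega0 R).
Variables (Rs : 'I_T -> Omega0 -> {set 'I_n}) (Ls : 'I_T -> Omega0 -> {set 'I_d}).
Context (dsp : measure_display) (Omega : measurableType dsp).
Context (P : probability Omega R).
Variables (Rk : nat -> 'I_T -> Omega -> {set 'I_n}).
Variables (Lk : nat -> 'I_T -> Omega -> {set 'I_d}).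
Hypothesis mRL0 : forall c, sampling_events Rs Ls c `<=` measurable.
Hypothesis indep : mutually_independent P0 (sampling_events Rs Ls).
Hypothesis fresh : fresh_copies P0 Rs Ls P Rk Lk.

Let past (k : nat) : seq (nat * ('I_T + 'I_T)) :=
  [seq (l, c) | l <- iota 0 k, c <- index_enum ('I_T + 'I_T)%type].

(** One event for each sampling drawn before step [k], intersected: the very shape to which mutual
    independence applies, in place of a sigma-algebra of the past. *)
Definition cylinder (k : nat) (A : set Omega) : Prop :=
  exists G : nat * ('I_T + 'I_T) -> set Omega,
    (forall l, sampling_events (Rk l.1) (Lk l.1) l.2 (G l)) /\
    A = \big[setI/setT]_(l <- past k) G l.

Lemma cylinder0 : cylinder 0 setT.
Proof.
exists (fun l => sample_slice (Rk l.1) (Lk l.1)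
                   ([ffun=> finset.set0], [ffun=> finset.set0]) l.2).
by split=> [l|]; [exact: sample_slice_events|rewrite /past /= big_nil].
Qed.

Lemma cylinder_measurable k A : cylinder k A -> measurable A.
Proof.
move=> [G [evG ->]]; apply: bigsetI_measurable => l _.
by have [mRL _ _ _] := fresh; exact: mRL (evG l).
Qed.

Let past_uniq k : uniq (past k).
Proof.
apply: allpairs_uniq => [||[l c] [l' c'] _ _ //]; first exact: iota_uniq.
exact: index_enum_uniq.
Qed.

Let pastS k :
  past k.+1 = past k ++ [seq (k, c) | c <- index_enum ('I_T + 'I_T)%type].
Proof. by rewrite /past -addn1 iotaD allpairs_cat /= cats0. Qed.

(** The slices at step [k] extend the family of events by fresh indices, so mutual independence
    factors the probability. Each slice has the same law as under [P0], where independence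
    reassembles the product. *)
Lemma cylinderS k A s : cylinder k A ->
  cylinder k.+1 (A `&` [set w | sample_of (Rk k) (Lk k) w = s]) /\
  P (A `&` [set w | sample_of (Rk k) (Lk k) w = s]) =
    (P A * P0 [set w | sample_of Rs Ls w = s])%E.
Proof.
move=> [G [evG AE]].
pose G' (l : nat * ('I_T + 'I_T)) :=
  if l.1 == k then sample_slice (Rk k) (Lk k) s l.2 else G l.
have evG' l : sampling_events (Rk l.1) (Lk l.1) l.2 (G' l).
  by rewrite /G'; case: eqP => // ->; exact: sample_slice_events.
have GG' l : l \in past k -> G' l = G l.
  move=> /allpairsP[[l1 c] /= [+ _ ->]]; rewrite mem_iota add0n /= => lk.
  by rewrite /G' /= ltn_eqF.
have AE' : A = \big[setI/setT]_(l <- past k) G' l.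
  by rewrite AE; apply: eq_big_seq => l /GG'.
have AsE : A `&` [set w | sample_of (Rk k) (Lk k) w = s] =
    \big[setI/setT]_(l <- past k.+1) G' l.
  rewrite pastS big_cat -AE' big_map sample_ofE; congr (_ `&` _).
  by apply: eq_bigr => c _; rewrite /G' /= eqxx.
split; first by exists G'.
have [_ PR PL indepk] := fresh.
rewrite AsE indepk// pastS big_cat /=; congr (_ * _)%E.
  by rewrite AE' indepk.
rewrite sample_ofE indep ?index_enum_uniq//; last first.
  by move=> c _; exact: sample_slice_events.
rewrite big_map; apply: eq_bigr => c _; rewrite /G' /= eqxx.
by case: c => t /=; [exact: PR|exact: PL].
Qed.

Lemma isaega_sample (f : 'I_n -> 'rV[R]_d -> R) (psi : 'rV[R]_d -> \bar R)
    (N : 'I_T -> {set 'I_n}) (p : 'I_T -> 'I_d -> R) (r : 'I_T -> 'I_n -> R)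
    (alpha : R) (x0 : 'rV[R]_d) (k : nat) w :
  let s := sample_of (Rk k) (Lk k) w in
  isaega f psi N p r alpha x0 Rk Lk k.+1 w =
  isaega_step f psi N p r alpha s.1 s.2 (isaega f psi N p r alpha x0 Rk Lk k w).
Proof.
move=> s.
have Rs1 : (fun t => Rk k t w) = s.1 by apply/funext => t; rewrite ffunE.
have Ls2 : (fun t => Lk k t w) = s.2 by apply/funext => t; rewrite ffunE.
by rewrite -Rs1 -Ls2.
Qed.

(** The state is a function of a finite record [Z] of all samples drawn so far; keeping the whole
    record makes each level set of [Z] a cylinder, hence independent of the samplings of step
    [k]. *)
Lemma isaega_finite_range (f : 'I_n -> 'rV[R]_d -> R) (psi : 'rV[R]_d -> \bar R)
    (N : 'I_T -> {set 'I_n}) (p : 'I_T -> 'I_d -> R) (r : 'I_T -> 'I_n -> R)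
    (alpha : R) (x0 : 'rV[R]_d) (k : nat) :
  exists (F : finType) (Z : Omega -> F) (st : F -> 'rV[R]_d * 'M[R]_(d, n)),
    (forall w, isaega f psi N p r alpha x0 Rk Lk k w = st (Z w)) /\
    (forall z, cylinder k [set w | Z w = z]).
Proof.
elim: k => [|k [F [Z [st [stE cylZ]]]]].
  exists unit, (fun=> tt), (fun=> (x0, 0)); split=> // -[].
  by rewrite (_ : [set w | _] = setT); [exact: cylinder0|apply/seteqP].
exists (F * sample)%type, (fun w => (Z w, sample_of (Rk k) (Lk k) w)),
  (fun z : F * sample => isaega_step f psi N p r alpha z.2.1 z.2.2 (st z.1)).
split=> [w|[z s]].
  by rewrite isaega_sample stE.
have [+ _] := cylinderS s (cylZ z); congr cylinder.
by apply/seteqP; split => w /= [-> ->].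
Qed.

(** Induction on [k]: conditioning on the record [Z] becomes a double finite sum whose weights
    factor by [cylinderS], and [drift] is applied at each value of [Z] separately. *)
Lemma isaega_expectation_le (f : 'I_n -> 'rV[R]_d -> R)
    (psi : 'rV[R]_d -> \bar R) (N : 'I_T -> {set 'I_n})
    (p : 'I_T -> 'I_d -> R) (r : 'I_T -> 'I_n -> R) (alpha rho : R)
    (x0 : 'rV[R]_d) (V : 'rV[R]_d * 'M[R]_(d, n) -> R) (k : nat) :
  0 <= rho -> (forall z, 0 <= V z) ->
  (forall z, fmean (fun s => fine (P0 [set w | sample_of Rs Ls w = s]))
     (fun s : sample => V (isaega_step f psi N p r alpha s.1 s.2 z)) <= rho * V z) ->
  ('E_P[fun w => V (isaega f psi N p r alpha x0 Rk Lk k w)]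
    <= (rho ^+ k * V (x0, 0%R))%:E)%E.
Proof.
move=> rho0 V0 drift; elim: k => [|k IHk].
  by rewrite expr0 mul1r /= expectation_cst.
have [F [Z [st [stE cylZ]]]] := isaega_finite_range f psi N p r alpha x0 k.
have mZ z := cylinder_measurable (cylZ z).
move: IHk.
have -> : (fun w => V (isaega f psi N p r alpha x0 Rk Lk k w)) =
    (fun w => V (st (Z w))).
  by apply/funext => w; rewrite stE.
rewrite (@expectation_finite_range _ _ _ _ _ Z mZ (V \o st)); last first.
  by move=> z; exact: V0.
move=> IHk.
have {}IHk : fmean (fun z => fine (P [set w | Z w = z])) (V \o st)
    <= rho ^+ k * V (x0, 0).
  by rewrite -lee_fin.
pose Z' w := (Z w, sample_of (Rk k) (Lk k) w).
have mZ' z : measurable [set w | Z' w = z].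
  case: z => z s; have [+ _] := cylinderS s (cylZ z) => /cylinder_measurable.
  congr measurable; apply/seteqP; split => w /= [zw sw] //.
  by rewrite /Z' zw sw.
pose phi (z : F * sample) := V (isaega_step f psi N p r alpha z.2.1 z.2.2 (st z.1)).
have -> : (fun w => V (isaega f psi N p r alpha x0 Rk Lk k.+1 w)) =
    (fun w => phi (Z' w)).
  by apply/funext => w; rewrite isaega_sample stE.
rewrite (@expectation_finite_range _ _ _ _ _ Z' mZ' phi); last first.
  by move=> z; exact: V0.
have -> : fmean (fun z => fine (P [set w | Z' w = z])) phi =
    \sum_z \sum_s fine (P [set w | Z' w = (z, s)]) * phi (z, s).
  by rewrite pair_bigA; apply: eq_bigr => -[z s].
rewrite lee_fin exprS -mulrA; apply: le_trans (ler_wpM2l rho0 IHk).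
rewrite /fmean mulr_sumr; apply: ler_sum => z _; rewrite mulrCA.
have := ler_wpM2l (fine_ge0 (measure_ge0 P [set w | Z w = z])) (drift (st z)).
apply: le_trans; rewrite mulr_sumr le_eqVlt; apply/orP; left; apply/eqP.
apply: eq_bigr => s _; rewrite mulrA; congr (_ * _).
have [_] := cylinderS s (cylZ z).
have -> : [set w | Z w = z] `&` [set w | sample_of (Rk k) (Lk k) w = s]
    = [set w | Z' w = (z, s)].
  by apply/seteqP; split => w /= [zw sw] //; rewrite /Z' zw sw.
move=> ->; rewrite fineM ?fin_num_measure//.
exact: sample_of_measurable.
Qed.
End Copies.
End Sampling.

(** * Moments of the refresh indicators *)

Section SamplingMoments.
Context (R : realType) (dsp0 : measure_display) (Omega0 : measurableType dsp0).
Context (P0 : probability Omega0 R) (d n T : nat) (N : 'I_T -> {set 'I_n}).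
Variables (Rs : 'I_T -> Omega0 -> {set 'I_n}) (Ls : 'I_T -> Omega0 -> {set 'I_d}).
Hypothesis samplings : distributed_sampling P0 N Rs Ls.

Let mR t (B : set {set 'I_n}) : measurable (Rs t @^-1` B).
Proof. by have [mRL _ _] := samplings; apply: (mRL (inl t)); exact: eventsP. Qed.

Let mL t (B : set {set 'I_d}) : measurable (Ls t @^-1` B).
Proof. by have [mRL _ _] := samplings; apply: (mRL (inr t)); exact: eventsP. Qed.

(** Entries of one machine share the row sampling [Ls t], so [probL] appears only once even when [j]
    and [j'] differ; taking [j = j'] gives the refresh probability of a single entry. *)
Lemma prob_refresh_same t i j j' :
  fine (P0 [set w | [/\ i \in Ls t w, j \in Rs t w & j' \in Rs t w]]) =
  probL P0 Ls t i * fine (P0 [set w | j \in Rs t w /\ j' \in Rs t w]).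
Proof.
have [_ _ indep] := samplings.
pose F (c : 'I_T + 'I_T) : set Omega0 :=
  match c with
  | inl t => Rs t @^-1` [set A : {set _} | j \in A /\ j' \in A]
  | inr t => Ls t @^-1` [set A : {set _} | i \in A]
  end.
have := indep [:: inr t; inl t] F isT.
rewrite !big_cons !big_nil setIT mule1 => indepF.
rewrite /probL -fineM ?fin_num_measure//; last 2 first.
- exact: (mL t [set A : {set _} | i \in A]).
- exact: (mR t [set A : {set _} | j \in A /\ j' \in A]).
rewrite -indepF; last by case=> u _; rewrite /F; exact: eventsP.
by congr (fine (P0 _)); apply/seteqP; split => w [] //= ? [].
Qed.

Lemma prob_refresh_diff t t' i j j' : t != t' ->
  fine (P0 [set w | (i \in Ls t w /\ j \in Rs t w) /\
                    (i \in Ls t' w /\ j' \in Rs t' w)]) =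
  (probL P0 Ls t i * probR P0 Rs t j) * (probL P0 Ls t' i * probR P0 Rs t' j').
Proof.
move=> tt'; have [_ _ indep] := samplings.
(* Two machines involve four distinct samplings; [t != t'] lets a single family ask for [j] on [t]
   and for [j'] on [t']. *)
pose F (c : 'I_T + 'I_T) : set Omega0 :=
  match c with
  | inl u => Rs u @^-1` [set A : {set _} | (if u == t then j else j') \in A]
  | inr u => Ls u @^-1` [set A : {set _} | i \in A]
  end.
have t't : (t' == t) = false by rewrite eq_sym; exact: negbTE.
have := indep [:: inr t; inl t; inr t'; inl t'] F.
rewrite !big_cons !big_nil setIT mule1 /F eqxx t't => indepF.
have finR u k : P0 (Rs u @^-1` [set A : {set _} | k \in A]) \is a fin_num.
  by apply: fin_num_measure; exact: mR.
have finL u : P0 (Ls u @^-1` [set A : {set _} | i \in A]) \is a fin_num.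
  by apply: fin_num_measure; exact: mL.
have := congr1 fine (indepF _ _); rewrite !fineM ?fin_numM// => indepF'.
rewrite /probL /probR -mulrA -indepF'.
- congr (fine (P0 _)); apply/seteqP; split => w /=.
    by move=> [[? ?] []].
  by move=> [? [? []]].
- rewrite /= !inE /= -[inr t == inr t']/(t == t') -[inl t == inl t']/(t == t').
  by rewrite (negbTE tt').
- by case=> u _; exact: eventsP.
Qed.

(** The Loewner inequality is tested on the vector with entries [c], then carried from matrices
    indexed through [enum_val] back to sums over [N t]. *)
Lemma loewner_quadratic t (q : 'I_n -> R) (c : 'I_n -> R) :
  (forall j, j \in N t -> 0 < probR P0 Rs t j) ->
  (forall j, j \in N t -> 0 < q j) ->
  loewner_le (invmx (diagN N t (probR P0 Rs t)) *m probmx P0 N Rs t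
                *m invmx (diagN N t (probR P0 Rs t))) (invmx (diagN N t q)) ->
  \sum_(j in N t) \sum_(j' in N t) c j * c j' *
      (fine (P0 [set w | j \in Rs t w /\ j' \in Rs t w])
       / (probR P0 Rs t j * probR P0 Rs t j'))
    <= \sum_(j in N t) c j ^+ 2 / q j.
Proof.
have invmx_diag (s : nat) (v : 'rV[R]_s) : (forall i, v 0 i != 0) ->
    invmx (diag_mx v) = diag_mx (\row_i (v 0 i)^-1).
  move=> v0; have vv : diag_mx v *m diag_mx (\row_i (v 0 i)^-1) = 1%:M.
    rewrite mulmx_diag -diag_const_mx; congr diag_mx; apply/rowP => i.
    by rewrite !mxE divff.
  by have [uv _] := mulmx1_unit vv; rewrite -[RHS](mulKmx uv) vv mulmx1.
move=> r0 q0 [_ /(_ (\col_a c (enum_val a)))].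
rewrite /diagN !invmx_diag; last 2 first.
- by move=> a; rewrite mxE lt0r_neq0// r0// enum_valP.
- by move=> a; rewrite mxE lt0r_neq0// q0// enum_valP.
rewrite mulmxBr mulmxBl [X in 0 <= X -> _]mxE [X in 0 <= _ + X -> _]mxE.
rewrite subr_ge0 => le12.
rewrite [leLHS]big_enum_val [leRHS]big_enum_val /=.
under [leLHS]eq_bigr do rewrite big_enum_val.
apply: le_trans (le_trans le12 _).
  rewrite mxE exchange_big /= le_eqVlt; apply/orP; left; apply/eqP.
  apply: eq_bigr => b _; rewrite [X in _ = X * _]mxE mulr_suml.
  apply: eq_bigr => a _; rewrite mul_mx_diag mul_diag_mx !mxE invfM.
  by ring.
rewrite mul_mx_diag mxE le_eqVlt; apply/orP; left; apply/eqP.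
by apply: eq_bigr => a _; rewrite !mxE; ring.
Qed.

End SamplingMoments.

(** * From the one-step contraction to the iteration complexity *)

Theorem corollaryM3 (R : realType) (d n T : nat)
    (f : 'I_n -> 'rV[R]_d -> R) (psi : 'rV[R]_d -> \bar R)
    (xs : 'rV[R]_d) (sigma : R) (m : 'I_n -> 'I_d -> R)
    (f_diff : forall j x, differentiable (f j) x)
    (f_convex : forall j, convex_function setT (f j))
    (psi_proper : eproper psi)
    (psi_closed : lower_semicontinuous psi)
    (psi_convex : econvex psi)
    (xs_min : argmin (fun x => ((avg f x)%:E + psi x)%E) = [set xs])
    (sigma_gt0 : 0 < sigma)
    (f_qsc : quasi_strongly_convex sigma xs (avg f))
    (m_gt0 : forall j i, 0 < m j i)
    (f_smooth : forall j, diag_smooth (m j) (f j))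
    (N : 'I_T -> {set 'I_n}) (N_part : owned_partition N)
    (dsp0 : measure_display) (Omega0 : measurableType dsp0)
    (P0 : probability Omega0 R)
    (Rs : 'I_T -> Omega0 -> {set 'I_n}) (Ls : 'I_T -> Omega0 -> {set 'I_d})
    (RL_sampling : distributed_sampling P0 N Rs Ls)
    (p_gt0 : forall t i, 0 < probL P0 Ls t i)
    (r_gt0 : forall t j, j \in N t -> 0 < probR P0 Rs t j)
    (q : 'I_T -> 'I_n -> R)
    (q_gt0 : forall t j, j \in N t -> 0 < q t j)
    (q_loewner : forall t,
       loewner_le (invmx (diagN N t (probR P0 Rs t)) *m probmx P0 N Rs t
                     *m invmx (diagN N t (probR P0 Rs t)))
                  (invmx (diagN N t (q t))))
    (alpha : R)
    (alpha_min : is_minimum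
       (values N (fun t j i =>
          stepsize_bound n sigma (m j i) (probL P0 Ls t i) (q t j))) alpha)
    (C : R)
    (C_max : is_maximum
       (values N (fun t j i =>
          complexity_bound n sigma (m j i) (probL P0 Ls t i) (q t j))) C)
    (x0 : 'rV[R]_d)
    (dsp : measure_display) (Omega : measurableType dsp)
    (P : probability Omega R)
    (Rk : nat -> 'I_T -> Omega -> {set 'I_n})
    (Lk : nat -> 'I_T -> Omega -> {set 'I_d})
    (RLk_fresh : fresh_copies P0 Rs Ls P Rk Lk) :
  exists B : 'M[R]_(d, n), (forall i j, 0 < B i j) /\
    forall (eps : R) (k : nat), 0 < eps < 1 -> C * ln (1 / eps) <= k%:R ->
      let Psi k w := lyapunov f m xs alpha B
        (isaega f psi N (probL P0 Ls) (probR P0 Rs) alpha x0 Rk Lk k w) in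
      let Psi0 := lyapunov f m xs alpha B (x0, 0) in
      ('E_P[Psi k] <= (eps * Psi0)%:E)%E.
Proof.
have [_ N_disj N_cover] := N_part.
(* Each column gets its owner, unique by disjointness, so that quantities indexed by a machine and
   one of its columns depend on the column alone. *)
have /boolp.choice[own ownN] j : exists t, j \in N t.
  have : j \in (\bigcup_(t < T) N t)%SET by rewrite N_cover inE.
  by case/bigcupP => t _ ?; exists t.
have oE t j : (j \in N t) = (own j == t).
  apply/idP/eqP => [jt|<-//]; apply/eqP; apply: contraT => /N_disj /setP /(_ j).
  by rewrite !inE ownN jt.
have [mRL R_sub indep0] := RL_sampling.
pose p i j := probL P0 Ls (own j) i.
pose r j := probR P0 Rs (own j) j.
pose q' j := q (own j) j.
have p0 i j : 0 < p i j by exact: p_gt0.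
have r0 j : 0 < r j by exact: r_gt0.
have q0 j : 0 < q' j by exact: q_gt0.
pose K j j' := fine (P0 [set w | j \in Rs (own j) w /\ j' \in Rs (own j) w]).
have Kjj j : K j j = r j.
  by congr (fine (P0 _)); apply/seteqP; split => w /= [].
have loew t (c : 'I_n -> R) : \sum_(j | own j == t) \sum_(j' | own j' == t)
    c j * c j' * (K j j' / (r j * r j')) <= \sum_(j | own j == t) c j ^+ 2 / q' j.
  have sumE (F : 'I_n -> R) : \sum_(j in N t) F j = \sum_(j | own j == t) F j.
    by apply: eq_bigl => j; exact: oE.
  have := loewner_quadratic c (@r_gt0 t) (@q_gt0 t) (q_loewner t).
  rewrite !sumE; under eq_bigr do rewrite sumE.
  have eqL : \sum_(j | own j == t) \sum_(j' | own j' == t) c j * c j' *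
      (fine (P0 [set w | j \in Rs t w /\ j' \in Rs t w])
       / (probR P0 Rs t j * probR P0 Rs t j')) =
    \sum_(j | own j == t) \sum_(j' | own j' == t)
      c j * c j' * (K j j' / (r j * r j')).
    apply: eq_bigr => j /eqP ojt; apply: eq_bigr => j' /eqP oj't.
    by rewrite /K /r ojt oj't.
  have eqR : \sum_(j | own j == t) c j ^+ 2 / q t j =
      \sum_(j | own j == t) c j ^+ 2 / q' j.
    by apply: eq_bigr => j /eqP ojt; rewrite /q' ojt.
  by rewrite eqL eqR.
(* Testing the Loewner inequality on the basis vector of [j] gives [1 / r j <= 1 / q' j], because
   [K j j = r j]. *)
have qr j : q' j <= r j.
  have sum1 (F : 'I_n -> R) : (forall j', j' != j -> F j' = 0) ->
      \sum_(j' | own j' == own j) F j' = F j.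
    by move=> F0; rewrite (bigD1 j)//= big1 ?addr0// => j' /andP[_ /F0].
  have := loew (own j) (fun j' => (j' == j)%:R).
  rewrite sum1; last by move=> j' /negbTE->; rewrite big1// => j'' _; rewrite !mul0r.
  rewrite sum1; last by move=> j' /negbTE->; rewrite mulr0 mul0r.
  rewrite sum1; last by move=> j' /negbTE->; rewrite expr0n mul0r.
  rewrite eqxx Kjj expr1n !mul1r invfM mulrA divff ?lt0r_neq0// mul1r.
  by rewrite lef_pV2 ?posrE.
have p1 i j : p i j <= 1.
  rewrite -lee_fin fineK ?fin_num_measure ?probability_le1//;
  exact: (mRL (inr (own j)) _ (eventsP _ [set A : {set _} | i \in A])).
have r1 j : r j <= 1.
  rewrite -lee_fin fineK ?fin_num_measure ?probability_le1//;
  exact: (mRL (inl (own j)) _ (eventsP _ [set A : {set _} | j \in A])).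
have bound_gt0 i j : 0 < 4 * m j i * (1 + (n%:R * p i j * q' j)^-1)
                         + sigma / (p i j * q' j).
  have n0 : (0 : R) < n%:R by rewrite ltr0n; apply: leq_trans (ltn_ord j).
  by rewrite addr_gt0 ?mulr_gt0 ?addr_gt0 ?invr_gt0 ?mulr_gt0.
have valE e a : values N e a -> exists j i, a = e (own j) j i.
  by case=> t [j [i []]]; rewrite oE => /eqP <- ->; exists j, i.
have [/valE[j0 [i0 alphaE]] alpha_le] := alpha_min.
have alpha0 : 0 < alpha by rewrite alphaE invr_gt0; exact: bound_gt0.
have stepsize i j : alpha * (4 * m j i * (1 + (n%:R * p i j * q' j)^-1)
                             + sigma / (p i j * q' j)) <= 1.
  rewrite -ler_pdivlMr// div1r; apply: alpha_le.
  by exists (own j), j, i.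
have as0 : 0 < alpha * sigma by rewrite mulr_gt0.
(* This makes the contraction factor [1 - alpha * sigma] nonnegative; [p * q <= 1] puts [sigma]
   below the term [sigma / (p * q)] of the stepsize bound. *)
have as1 : alpha * sigma <= 1.
  apply: le_trans (stepsize i0 j0); rewrite ler_pM2l//.
  have pq1 : p i0 j0 * q' j0 <= 1.
    by rewrite mulr_ile1 ?(ltW (p0 _ _)) ?(ltW (q0 _))// (le_trans (qr _)).
  have : sigma <= sigma / (p i0 j0 * q' j0).
    by rewrite ler_pdivlMr ?mulr_gt0// ler_piMr// ltW.
  move/le_trans; apply; rewrite lerDr.
  by rewrite !mulr_ge0 ?addr_ge0 ?invr_ge0 ?mulr_ge0// ltW.
(* At the indices [i0], [j0] attaining [alpha], the complexity bound equals [(alpha * sigma)^-1],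
   and [C] dominates it. *)
have C_ge : 1 <= alpha * sigma * C.
  have [_ C_le] := C_max.
  have : complexity_bound n sigma (m j0 i0) (p i0 j0) (q' j0) <= C.
    by apply: C_le; exists (own j0), j0, i0.
  suff -> : complexity_bound n sigma (m j0 i0) (p i0 j0) (q' j0)
      = (alpha * sigma)^-1 by rewrite -ler_pdivrMl// mulr1.
  rewrite invfM alphaE /stepsize_bound /complexity_bound -/(p i0 j0) -/(q' j0).
  rewrite invrK; field.
  have n0 : (0 : R) < n%:R by rewrite ltr0n; apply: leq_trans (ltn_ord j0).
  by rewrite !lt0r_neq0.
(* A square root, because the Lyapunov function squares [B] and the square must be the weight of
   [weight_balance]. *)
pose B : 'M[R]_(d, n) := \matrix_(i, j) Num.sqrt (2 * n%:R * p i j * r j)^-1.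
have B0 i j : 0 < (2 * n%:R * p i j * r j)^-1.
  have n0 : (0 : R) < n%:R by rewrite ltr0n; apply: leq_trans (ltn_ord j).
  by rewrite invr_gt0 !mulr_gt0.
have BE i j : B i j ^+ 2 = (2 * n%:R * p i j * r j)^-1.
  by rewrite mxE sqr_sqrtr// ltW.
exists B; split=> [i j|eps k /andP[eps0 eps1] kC].
  by rewrite mxE sqrtr_gt0.
have V0 z : 0 <= lyapunov f m xs alpha B z.
  rewrite addr_ge0 ?sqnorm_ge0// mulr_ge0 ?(ltW alpha0)//.
  apply: sumr_ge0 => i _; apply: sumr_ge0 => j _.
  by rewrite mulr_ge0 ?sqr_ge0// divr_ge0 ?sqr_ge0// ltW.
pose X i j (s : sample d n T) := (i \in s.2 (own j)) && (j \in s.1 (own j)).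
pose pi s := fine (P0 [set w | sample_of Rs Ls w = s]).
have msamp := sample_of_measurable mRL.
have XE i j : fmean pi (fun s => (X i j s)%:R) = p i j * r j.
  rewrite (fmean_finite_range P0 msamp) -Kjj -(prob_refresh_same RL_sampling).
  congr (fine (P0 _)); apply/seteqP; split => w /=; rewrite /X /= !ffunE.
    by move=> /andP[].
  by case=> -> ->.
have XXE i j j' : fmean pi (fun s => (X i j s)%:R * (X i j' s)%:R) =
    fine (P0 [set w | X i j (sample_of Rs Ls w) && X i j' (sample_of Rs Ls w)]).
  rewrite -(fmean_finite_range P0 msamp (fun s => X i j s && X i j' s)).
  by congr fmean; apply/funext => s; rewrite -natrM mulnb.
have XX i (c : 'I_n -> R) :
    fmean pi (fun s => (\sum_j (X i j s)%:R / (p i j * r j) * c j) ^+ 2)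
      <= (\sum_j c j) ^+ 2 + \sum_j c j ^+ 2 / (p i j * q' j).
  apply: (second_moment (p := fun t => probL P0 Ls t i) (K := K)) => //.
  - move=> j j' jj'; rewrite XXE /K -(prob_refresh_same RL_sampling).
    congr (fine (P0 _)); apply/seteqP; split => w /=; rewrite /X /= -jj' !ffunE.
      by move=> /andP[/andP[-> ->] /andP[_ ->]].
    by case=> -> -> ->.
  - move=> j j' jj'; rewrite XXE /r -(prob_refresh_diff RL_sampling)//.
    congr (fine (P0 _)); apply/seteqP; split => w /=; rewrite /X /= !ffunE.
      by move=> /andP[/andP[-> ->] /andP[-> ->]].
    by case=> -[-> ->] [-> ->].
have tableE (s : sample d n T) x J i j : table_step f N s.1 s.2 x J i j =
    if X i j s then grad (f j) x 0 i else J i j.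
  rewrite [LHS]mxE; congr (if _ then _ else _); apply/existsP/idP.
    by case=> t /and3P[]; rewrite oE /X => /eqP -> -> ->.
  by move=> /andP[ij jj]; exists (own j); rewrite ownN ij jj.
have estE (s : sample d n T) x J i : estimator N (probL P0 Ls) (probR P0 Rs) J
    (table_step f N s.1 s.2 x J) 0 i = n%:R^-1 *
     \sum_j (J i j + (X i j s)%:R / (p i j * r j) * (grad (f j) x 0 i - J i j)).
  rewrite [LHS]mxE -mulrDr big_split; congr (_ * (_ + _)).
  (* Grouping the columns by owner matches the double sum over machines and their columns. *)
  rewrite [RHS](partition_big own predT)//=; apply: eq_bigr => t _.
  apply: eq_big => [j|j]; rewrite oE // => /eqP <-; rewrite tableE -/(p i j) -/(r j).
  by case: (X i j s); rewrite ?mul1r// subrr !mul0r mulr0.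
have drift z : fmean pi (fun s => lyapunov f m xs alpha B
    (isaega_step f psi N (probL P0 Ls) (probR P0 Rs) alpha s.1 s.2 z))
    <= (1 - alpha * sigma) * lyapunov f m xs alpha B z.
  case: z => x J; apply: (lyapunov_contraction (X := X) (p := p) (r := r) (q := q')
    (g := fun s => estimator N (probL P0 Ls) (probR P0 Rs) J
                     (table_step f N s.1 s.2 x J))
    f_diff f_convex f_smooth m_gt0 psi_proper psi_closed psi_convex _
    sigma_gt0 f_qsc) => //.
  - by rewrite xs_min.
  - by move=> s; exact: fine_ge0.
  - exact: sum_finite_range msamp.
  - by move=> s i j; exact: tableE.
have rho0 : 0 <= 1 - alpha * sigma by rewrite subr_ge0.
have := isaega_expectation_le mRL indep0 RLk_fresh x0 k rho0 V0 drift.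
move=> /le_trans; apply; rewrite lee_fin ler_wpM2r//.
(* [(1 - alpha * sigma) ^+ k] is at most [expR (- (alpha * sigma * k))], which
   [C * ln (1 / eps) <= k] and [1 <= alpha * sigma * C] bound by [eps]. *)
have le_exp : 1 - alpha * sigma <= expR (- (alpha * sigma)) by exact: expR_ge1Dx.
apply: (le_trans (lerXn2r k _ _ le_exp)); rewrite ?nnegrE ?expR_ge0//.
rewrite -expRM_natl -[leRHS]lnK ?posrE// ler_expR.
move: kC; rewrite div1r lnV ?posrE// => kC.
have : alpha * sigma * (C * - ln eps) <= alpha * sigma * k%:R by rewrite ler_pM2l.
have : - ln eps <= alpha * sigma * C * - ln eps.
  by rewrite ler_peMl// oppr_ge0 ln_le0// ltW.
by rewrite mulrN -mulr_natl; lra.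
Qed.
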